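(* Let $n\ge 3$, let $A$ be a quasi-finite ring (i.e. a quasi-finite algebra over some commutative ring $R$), and let $I$, $J$, $K$ be three two-sided ideals of $A$. Then $$\Big[[E(n,A,I),\mathrm{GL}(n,A,J)],\mathrm{GL}(n,A,K)\Big]=\Big[[E(n,A,I),E(n,A,J)],E(n,A,K)\Big].$$
   Context: Rings are associative with $1$. An $R$-algebra $A$ ($R$ commutative, acting centrally) is module finite over $R$ if it is finitely generated as an $R$-module; it is quasi-finite over $R$ if there is a direct system of module finite $R$-subalgebras $A_i$ of $A$ with $\varinjlim A_i=A$. For $1\le i\ne j\le n$ and $\xi\in A$, $e_{ij}(\xi)=e+\xi e_{ij}$ is the elementary matrix ($e$ the identity matrix, $e_{ij}$ the standard matrix unit). $E(n,A)\le \mathrm{GL}(n,A)$ is the subgroup generated by all $e_{ij}(\xi)$, $\xi\in A$. For a two-sided ideal $I$ of $A$: $\mathrm{GL}(n,A,I)=\ker(\mathrm{GL}(n,A)\to\mathrm{GL}(n,A/I))$; $E(n,I)$ is the subgroup generated by all $e_{ij}(\xi)$ with $\xi\in I$; $E(n,A,I)$ is the normal closure of $E(n,I)$ in $E(n,A)$. For subgroups $H,K$ of a group, $[H,K]$ is the subgroup generated by all $[x,y]=xyx^{-1}y^{-1}$, $x\in H,y\in K$. *)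

(* Defs.v *)
From HB Require Import structures.
From mathcomp Require Import all_boot all_algebra.
From mathcomp Require Import monoid generic_quotient boolp classical_sets.

Set Implicit Arguments.
Unset Strict Implicit.
Unset Printing Implicit Defensive.

Import GRing.Theory.
Local Open Scope ring_scope.
Local Open Scope quotient_scope.
Local Open Scope classical_set_scope.

(* Rings are [pzRingType]s, so that the zero ring is allowed; this matters for
   the quotient of A by the unit ideal. *)

Section Subgroups.
Variable G : groupType.
Implicit Types (S H K : set G) (x y : G).

Definition is_subgroup H :=
  [/\ H 1%g,
      forall x y, H x -> H y -> H (x * y)%g &
      forall x, H x -> H x^-1%g].

Definition gen S : set G := smallest is_subgroup S.

(* This is not the library's [~ x, y], which is x^-1 y^-1 x y. *)
Definition comm x y : G := (x * y * x^-1 * y^-1)%g.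

Definition commgs H K : set G := gen [set comm x y | x in H & y in K].

Definition is_normal_subgroup_of K H :=
  [/\ is_subgroup H, H `<=` K &
      forall k h, K k -> H h -> H (k * h * k^-1)%g].

Definition normal_closure_in K S : set G :=
  smallest (is_normal_subgroup_of K) S.

End Subgroups.

(* A unit is stored together with its inverse; as inverses are unique, two units
   are equal if and only if the underlying elements are. *)
Record ring_units (S : pzRingType) := RingUnit {
  unit_pair : S * S;
  _ : (unit_pair.1 * unit_pair.2 == 1) && (unit_pair.2 * unit_pair.1 == 1) }.

Section RingUnits.
Variable S : pzRingType.
Implicit Types u v w : ring_units S.

HB.instance Definition _ := [isSub for @unit_pair S].
HB.instance Definition _ := [Choice of ring_units S by <:].

Definition unit_val u : S := (unit_pair u).1.
Definition unit_inv u : S := (unit_pair u).2.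

Lemma unit_valV u : unit_val u * unit_inv u = 1.
Proof. by case/andP: (valP u) => /eqP. Qed.

Lemma unit_Vval u : unit_inv u * unit_val u = 1.
Proof. by case/andP: (valP u) => _ /eqP. Qed.

Lemma mk_unit_subproof (x y : S) :
  x * y = 1 -> y * x = 1 -> (x * y == 1) && (y * x == 1).
Proof. by move=> -> ->; rewrite eqxx. Qed.

Definition mk_unit (x y : S) (xy : x * y = 1) (yx : y * x = 1) : ring_units S :=
  @RingUnit S (x, y) (mk_unit_subproof xy yx).

Lemma unit_val_inj : injective unit_val.
Proof.
move=> u v uv; have uvV : unit_inv u = unit_inv v.
  by rewrite -[LHS]mulr1 -(unit_valV v) -uv mulrA unit_Vval mul1r.
apply: val_inj; rewrite /= [unit_pair u]surjective_pairing.
by rewrite [unit_pair v]surjective_pairing; congr (_, _).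
Qed.

Definition one_unit : ring_units S := mk_unit (mulr1 1) (mulr1 1).

Lemma mul_unit_subproof1 u v :
  (unit_val u * unit_val v) * (unit_inv v * unit_inv u) = 1.
Proof. by rewrite mulrA -(mulrA (unit_val u)) unit_valV mulr1 unit_valV. Qed.

Lemma mul_unit_subproof2 u v :
  (unit_inv v * unit_inv u) * (unit_val u * unit_val v) = 1.
Proof. by rewrite mulrA -(mulrA (unit_inv v)) unit_Vval mulr1 unit_Vval. Qed.

Definition mul_unit u v : ring_units S :=
  mk_unit (mul_unit_subproof1 u v) (mul_unit_subproof2 u v).

Definition inv_unit u : ring_units S := mk_unit (unit_Vval u) (unit_valV u).

Lemma mul_unitA : associative mul_unit.
Proof. by move=> u v w; apply: unit_val_inj; apply: mulrA. Qed.

Lemma mul_unit1 : right_id one_unit mul_unit.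
Proof. by move=> u; apply: unit_val_inj; apply: mulr1. Qed.

Lemma mul_1unit : left_id one_unit mul_unit.
Proof. by move=> u; apply: unit_val_inj; apply: mul1r. Qed.

Lemma mul_unitV : right_inverse one_unit inv_unit mul_unit.
Proof. by move=> u; apply: unit_val_inj; apply: unit_valV. Qed.

Lemma mul_Vunit : left_inverse one_unit inv_unit mul_unit.
Proof. by move=> u; apply: unit_val_inj; apply: unit_Vval. Qed.

HB.instance Definition _ := isGroup.Build (ring_units S)
  mul_unitA mul_1unit mul_unit1 mul_Vunit mul_unitV.

End RingUnits.

Section UnitsMap.
Variables (S T : pzRingType) (f : {rmorphism S -> T}).

Lemma units_map_subproof1 (u : ring_units S) :
  f (unit_val u) * f (unit_inv u) = 1.
Proof. by rewrite -rmorphM unit_valV rmorph1. Qed.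

Lemma units_map_subproof2 (u : ring_units S) :
  f (unit_inv u) * f (unit_val u) = 1.
Proof. by rewrite -rmorphM unit_Vval rmorph1. Qed.

Definition units_map (u : ring_units S) : ring_units T :=
  mk_unit (units_map_subproof1 u) (units_map_subproof2 u).

End UnitsMap.

Record two_sided_ideal (A : pzRingType) := TwoSidedIdeal {
  ideal_set :> A -> Prop;
  ideal0 : ideal_set 0;
  idealD : forall x y, ideal_set x -> ideal_set y -> ideal_set (x + y);
  idealMl : forall a x, ideal_set x -> ideal_set (a * x);
  idealMr : forall a x, ideal_set x -> ideal_set (x * a) }.

Section QuotientRing.
Variables (A : pzRingType) (I : two_sided_ideal A).

Lemma idealN x : I x -> I (- x).
Proof. by rewrite -mulN1r; apply: idealMl. Qed.

Lemma idealB x y : I x -> I y -> I (x - y).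
Proof. by move=> Ix Iy; apply: idealD => //; apply: idealN. Qed.

Definition eq_mod_ideal (x y : A) : bool := `[< I (x - y) >].

Lemma eq_mod_ideal_equiv : equiv_class_of eq_mod_ideal.
Proof.
split=> [x|x y|y x z].
- by apply/asboolP; rewrite subrr; apply: ideal0.
- by apply/asboolP/asboolP => /idealN; rewrite opprB.
- move=> /asboolP xy /asboolP yz; apply/asboolP.
  by rewrite -(subrKA y); apply: idealD.
Qed.

Canonical eq_mod_ideal_rel := EquivRelPack eq_mod_ideal_equiv.

Definition quotient_ring := {eq_quot eq_mod_ideal}%qT.

HB.instance Definition _ := Choice.on quotient_ring.
HB.instance Definition _ := EqQuotient.on quotient_ring.

Lemma quotient_eqP (x y : A) :
  reflect (I (x - y)) (\pi_quotient_ring x == \pi_quotient_ring y).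
Proof. by rewrite eqquotE; apply: asboolP. Qed.

Lemma quotient_reprP (x : A) : I (repr (\pi_quotient_ring x) - x).
Proof. by apply/quotient_eqP; rewrite reprK. Qed.

Let pi := \pi_quotient_ring.
Definition q_add (u v : quotient_ring) : quotient_ring := pi (repr u + repr v).
Definition q_opp (u : quotient_ring) : quotient_ring := pi (- repr u).
Definition q_mul (u v : quotient_ring) : quotient_ring := pi (repr u * repr v).

Lemma q_addE x y : q_add (pi x) (pi y) = pi (x + y).
Proof.
apply/eqP/quotient_eqP; rewrite opprD addrACA.
by apply: idealD; apply: quotient_reprP.
Qed.

Lemma q_oppE x : q_opp (pi x) = pi (- x).
Proof.
by apply/eqP/quotient_eqP; rewrite -opprD; apply/idealN/quotient_reprP.
Qed.

Lemma q_mulE x y : q_mul (pi x) (pi y) = pi (x * y).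
Proof.
apply/eqP/quotient_eqP; rewrite -(subrKA (x * repr (pi y))) -mulrBl -mulrBr.
by apply: idealD; [apply: idealMr | apply: idealMl]; apply: quotient_reprP.
Qed.

Lemma q_ind (P : quotient_ring -> Prop) : (forall x, P (pi x)) -> forall u, P u.
Proof. by move=> Ppi u; rewrite -[u]reprK; apply: Ppi. Qed.

Lemma q_addA : associative q_add.
Proof.
by elim/q_ind=> x; elim/q_ind=> y; elim/q_ind=> z; rewrite !q_addE addrA.
Qed.

Lemma q_addC : commutative q_add.
Proof. by elim/q_ind=> x; elim/q_ind=> y; rewrite !q_addE addrC. Qed.

Lemma q_add0 : left_id (pi 0) q_add.
Proof. by elim/q_ind=> x; rewrite q_addE add0r. Qed.

Lemma q_addN : left_inverse (pi 0) q_opp q_add.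
Proof. by elim/q_ind=> x; rewrite q_oppE q_addE addNr. Qed.

HB.instance Definition _ :=
  GRing.isZmodule.Build quotient_ring q_addA q_addC q_add0 q_addN.

Lemma q_mulA : associative q_mul.
Proof.
by elim/q_ind=> x; elim/q_ind=> y; elim/q_ind=> z; rewrite !q_mulE mulrA.
Qed.

Lemma q_mul1 : right_id (pi 1) q_mul.
Proof. by elim/q_ind=> x; rewrite q_mulE mulr1. Qed.

Lemma q_1mul : left_id (pi 1) q_mul.
Proof. by elim/q_ind=> x; rewrite q_mulE mul1r. Qed.

Lemma q_mulDl : left_distributive q_mul q_add.
Proof.
elim/q_ind=> x; elim/q_ind=> y; elim/q_ind=> z.
by rewrite !(q_mulE, q_addE) mulrDl.
Qed.

Lemma q_mulDr : right_distributive q_mul q_add.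
Proof.
elim/q_ind=> x; elim/q_ind=> y; elim/q_ind=> z.
by rewrite !(q_mulE, q_addE) mulrDr.
Qed.

HB.instance Definition _ := GRing.Zmodule_isPzRing.Build quotient_ring
  q_mulA q_1mul q_mul1 q_mulDl q_mulDr.

Definition quotient_map (x : A) : quotient_ring := pi x.

Lemma quotient_map_zmod_morphism : zmod_morphism quotient_map.
Proof. by move=> x y; rewrite /quotient_map -q_addE -q_oppE. Qed.

Lemma quotient_map_monoid_morphism : monoid_morphism quotient_map.
Proof. by split=> // x y; rewrite /quotient_map -q_mulE. Qed.

HB.instance Definition _ :=
  GRing.isZmodMorphism.Build A quotient_ring quotient_map
    quotient_map_zmod_morphism.
HB.instance Definition _ :=
  GRing.isMonoidMorphism.Build A quotient_ring quotient_map
    quotient_map_monoid_morphism.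

End QuotientRing.

(* An R-algebra structure on A is given by its structure map phi : R -> A, with
   central image; the scalar action is r . a = phi r * a. *)

Section QuasiFinite.
Variables (R : comPzRingType) (A : pzRingType) (phi : {rmorphism R -> A}).
Implicit Type B : set A.

Definition is_subalgebra B :=
  [/\ B 1,
      forall x y, B x -> B y -> B (x - y),
      forall x y, B x -> B y -> B (x * y) &
      forall r x, B x -> B (phi r * x)].

Definition module_finite B :=
  exists (k : nat) (b : 'I_k -> A),
    (forall i, B (b i)) /\
    forall x, B x -> exists r : 'I_k -> R, x = \sum_i phi (r i) * b i.

Definition is_directed (T : Type) (le : T -> T -> Prop) :=
  [/\ inhabited T,
      forall i, le i i,
      forall i j k, le i j -> le j k -> le i k &
      forall i j, exists k, le i k /\ le j k].

(* The transition maps of a direct system of subalgebras of A are inclusions,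
   hence its direct limit is the union of the subalgebras. *)
Definition quasi_finite :=
  exists (T : Type) (le : T -> T -> Prop) (B : T -> set A),
    [/\ is_directed le,
        forall i j, le i j -> B i `<=` B j,
        forall i, is_subalgebra (B i),
        forall i, module_finite (B i) &
        \bigcup_i B i = setT].

End QuasiFinite.

Definition quasi_finite_ring (A : pzRingType) :=
  exists (R : comPzRingType) (phi : {rmorphism R -> A}),
    (forall r a, phi r * a = a * phi r) /\ quasi_finite phi.

Notation GL n A := (ring_units 'M[A]_n).

Section LinearGroups.
Variables (n : nat) (A : pzRingType).
Implicit Types (i j : 'I_n) (xi : A) (I : two_sided_ideal A).

Definition elem_mx i j xi : 'M[A]_n := 1%:M + xi *: delta_mx i j.

Lemma elem_mxK i j xi : i != j -> elem_mx i j xi * elem_mx i j (- xi) = 1.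
Proof.
move=> neq_ij; rewrite /elem_mx mulrDl mul1r mulrDr mulr1.
have -> : (xi *: delta_mx i j : 'M_n) * (- xi *: delta_mx i j) = 0; last first.
  by rewrite addr0 -addrA scaleNr addNr addr0.
apply/matrixP=> k l; rewrite !mxE big1 // => m _; rewrite !mxE.
case: (eqVneq m j) => [->|]; last by rewrite andbF mulr0 mul0r.
by rewrite (eq_sym j) (negPf neq_ij) /= !mulr0.
Qed.

Lemma elem_mxVK i j xi : i != j -> elem_mx i j (- xi) * elem_mx i j xi = 1.
Proof. by move=> neq_ij; rewrite -{2}[xi]opprK elem_mxK. Qed.

Definition elem i j (neq_ij : i != j) xi : GL n A :=
  mk_unit (elem_mxK xi neq_ij) (elem_mxVK xi neq_ij).

Definition elementary_group : set (GL n A) :=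
  gen [set g | exists i j (neq_ij : i != j) xi, g = elem neq_ij xi].

Definition elementary_group_ideal I : set (GL n A) :=
  gen [set g | exists i j (neq_ij : i != j) xi, I xi /\ g = elem neq_ij xi].

Definition relative_elementary_group I : set (GL n A) :=
  normal_closure_in elementary_group (elementary_group_ideal I).

Definition principal_congruence_subgroup I : set (GL n A) :=
  [set g | units_map (map_mx (quotient_map I)) g = 1%g].

End LinearGroups.

Arguments elementary_group n A : clear implicits.
Arguments elementary_group_ideal n {A} I.
Arguments relative_elementary_group n {A} I.
Arguments principal_congruence_subgroup n {A} I.

(* Main.v *)
Require Import Defs.
From HB Require Import structures.
From mathcomp Require Import all_boot all_algebra.
From mathcomp Require Import monoid generic_quotient boolp classical_sets.

From Stdlib Require Ncring Ncring_tac.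

(* The elementary group E(n, A, I) is normal in GL(n, A), and modulo
   N = E(n, A, IJ + JI) the group [E(n, A, I), E(n, A, J)] is generated by the
   elementary commutators y_ij(a, b) = [e_ij(a), e_ji(b)], which are central in
   the image of E(n, A). So it is enough to show, first, that [e_ij(a), g] lies in
   [E(n, A, I), E(n, A, J)] for g in GL(n, A, J) and, second, that y_ij(a, b)
   commutes with g in GL(n, A, K) modulo
   T = [[E(n, A, I), E(n, A, J)], E(n, A, K)].

   In both cases the elements r of R for which the claim holds for all r a form
   an ideal. The algebra is semilocal at every maximal ideal m, so that by stable
   rank 1 one may multiply g by an element of E(n, A, J) (resp. E(n, A, K)) and
   assume that a diagonal entry y of g^-1 satisfies y x = x y = s for some s in R
   outside m. Then g e_ij(s^2 a) g^-1 is an explicit product of elementary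
   matrices, which avoids all denominators and settles the first claim.

   For the second one, y_12(s^2 a, s^2 b) is rewritten modulo T as a commutator
   [P, Q] with P = 1 + (g^-1 e_1) (x a) (s e_2^T - c x e_1^T), c = (g^-1)_21,
   chosen so that g P g^-1 is supported on the first row, and Q = e_21(s^2 b). The
   commutator of g P g^-1 and g Q g^-1 is bimultiplicative modulo T, hence equal
   to a product of y_1m(a_m, b_m), and the rules y_ij(a k, b) = y_im(a, k b) for k
   in K and y_ij(a u, b) = y_ij(a, u b) for u in 1 + K, both valid modulo T,
   collapse this product to y_12(s^2 a, s^2 b) again. *)

Set Implicit Arguments.
Unset Strict Implicit.
Unset Printing Implicit Defensive.

Import GRing.Theory.
Local Open Scope ring_scope.

(** * Noncommutative ring normalization *)

#[local] Instance pzring_ops (A : pzRingType) :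
  @Ncring.Ring_ops A (0 : A) (1 : A) (@GRing.add A) (@GRing.mul A)
    (fun x y => x - y) (@GRing.opp A) (@eq A) := {}.

#[local] Instance pzring_ncring (A : pzRingType) :
  @Ncring.Ring A _ _ _ _ _ _ _ (pzring_ops A).
Proof.
split; rewrite /Algebra_syntax.equality /Ncring.eq_notation.
- exact: RelationClasses.eq_equivalence.
- by move=> x _ <- y _ <-.
- by move=> x _ <- y _ <-.
- by move=> x _ <- y _ <-.
- by move=> x _ <-.
- exact: add0r.
- exact: addrC.
- exact: addrA.
- exact: mul1r.
- exact: mulr1.
- exact: mulrA.
- by move=> x y z; apply: mulrDl.
- by move=> x y z; apply: mulrDr.
- by [].
- exact: addrN.
Qed.

Ltac ncring := Ncring_tac.non_commutative_ring.

(** * Module finite algebras at a maximal ideal *)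

Lemma ex_measure_max (T : Type) (F : T -> Prop) (f : T -> nat) (d : nat) :
    (exists x, F x) -> (forall x, F x -> (f x <= d)%N) ->
  exists2 x, F x & forall y, F y -> (f y <= f x)%N.
Proof.
move=> [x0 Fx0] fd.
pose P e := `[< exists2 x, F x & f x = e >].
have exP : exists e, P e by exists (f x0); apply/asboolP; exists x0.
have leP : forall e, P e -> (e <= d)%N by move=> e /asboolP[x /fd + <-].
case: (ex_maxnP exP leP) => e /asboolP[x Fx fx] maxe; exists x => // y Fy.
by rewrite fx; apply: maxe; apply/asboolP; exists y.
Qed.

Section LocalAlgebra.
Variables (R : comPzRingType) (A : pzRingType) (phi : {rmorphism R -> A}).
Hypothesis phiC : forall r a, phi r * a = a * phi r.

Variable m : R -> Prop.
Hypotheses (m0 : m 0) (mD : forall r s, m r -> m s -> m (r + s)).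
Hypothesis mM : forall r s, m s -> m (r * s).
Hypotheses (m1 : ~ m 1) (m_max : forall r, ~ m r -> exists t, m (1 - t * r)).

Let maxN r : m r -> m (- r).
Proof. by move=> mr; rewrite -mulN1r; apply: mM. Qed.

Lemma max_prime r s : ~ m r -> ~ m s -> ~ m (r * s).
Proof.
move=> nmr nms mrs; have [t mt] := m_max nmr; apply: nms.
have -> : s = (1 - t * r) * s + t * (r * s) by rewrite mulrBl mul1r mulrA subrK.
by apply: mD; [rewrite mulrC|]; apply: mM.
Qed.

Variables (B : A -> Prop) (k : nat) (b : nat -> A).
Hypotheses (B1 : B 1) (BB : forall x y, B x -> B y -> B (x - y)).
Hypothesis BM : forall x y, B x -> B y -> B (x * y).
Hypothesis Bphi : forall r x, B x -> B (phi r * x).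
Hypothesis Bb : forall i, (i < k)%N -> B (b i).
Hypothesis Bspan :
  forall x, B x -> exists r : nat -> R, x = \sum_(i < k) phi (r i) * b i.

Let B0 : B 0.
Proof. by rewrite -(subrr 1); apply: BB. Qed.

Let BN x : B x -> B (- x).
Proof. by rewrite -sub0r; apply/BB/B0. Qed.

Let BD x y : B x -> B y -> B (x + y).
Proof. by move=> Bx By; rewrite -[y]opprK; apply/BB/BN. Qed.

Let Bsum (I : finType) (F : I -> A) :
  (forall i, B (F i)) -> B (\sum_i F i).
Proof. by move=> BF; elim/big_rec: _ => [|i x _]; [apply: B0|apply: BD]. Qed.

Let BX x j : B x -> B (x ^+ j).
Proof. by move=> Bx; elim: j => [|j IH]; rewrite ?expr0 // exprS; apply: BM. Qed.

(** The [R]-submodules of [B] that contain [mB], hence the subspaces of the finite dimensional space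
    B/mB over R/m. Working with preimages in [B] avoids forming the quotient. *)
Definition is_submodule (X : A -> Prop) :=
  [/\ X 0, forall x, X x -> B x,
      forall r i, m r -> (i < k)%N -> X (phi r * b i),
      forall x y, X x -> X y -> X (x - y) &
      forall r x, X x -> X (phi r * x)].

(** The pivot positions of an echelon form: for a submodule [X], their number is the dimension of
    the preimage of [X] in (R/m)^k, even if the [b i] are dependent modulo [m]. *)
Definition leads (X : A -> Prop) : {set 'I_k} :=
  [set j : 'I_k | `[< exists r : nat -> R,
                        X (\sum_(i < j) phi (r i) * b i + b j) >]].

Lemma leadsS (X Y : A -> Prop) :
  (forall x, X x -> Y x) -> leads X \subset leads Y.
Proof.
move=> XY; apply/fintype.subsetP => j; rewrite !finset.in_set => /asboolP[r Xr].
by apply/asboolP; exists r; apply: XY.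
Qed.

(* A submodule is determined, within a larger one, by its set of leading
   positions: this is the strictly monotone dimension behind both chain
   conditions. *)
Lemma leads_sub (X Y : A -> Prop) : is_submodule X -> is_submodule Y ->
    (forall x, X x -> Y x) -> leads Y \subset leads X ->
  forall y, Y y -> X y.
Proof.
move=> [X0 XsB Xm XB XZ] [_ YsB Ym YB YZ] XY /fintype.subsetP lYX y Yy.
have XD x z : X x -> X z -> X (x + z).
  by move=> Xx Xz; rewrite -[z]opprK; apply: (XB) => //; rewrite -sub0r; apply: XB.
have [r Dy] := Bspan (YsB _ Yy); move: Yy; rewrite {y}Dy; move: r (leqnn k).
suff H j (r : nat -> R) : (j <= k)%N ->
    Y (\sum_(i < j) phi (r i) * b i) -> X (\sum_(i < j) phi (r i) * b i).
  by move=> r; apply: H.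
elim: j r => [|j IH] r ltjk; first by rewrite big_ord0.
rewrite big_ord_recr /= => Yy; set y := (X in Y X) in Yy *.
have [mr|/m_max[t mt]] := pselect (m (r j)).
  apply: XD (Xm _ _ mr ltjk); apply: IH; first exact: ltnW.
  by have := YB _ _ Yy (Ym _ _ mr ltjk); rewrite addrK.
have lead_tr : phi t * (phi (r j) * b j) = b j - phi (1 - t * r j) * b j.
  by rewrite mulrA -rmorphM rmorphB rmorph1 mulrBl mul1r subKr.
have lYj : Ordinal ltjk \in leads Y.
  rewrite finset.in_set; apply/asboolP; exists (fun i => t * r i) => /=.
  have := YZ t _ Yy; rewrite mulrDr lead_tr mulr_sumr addrA => Yt.
  have := YB _ _ Yt (YZ (-1) _ (Ym _ _ mt ltjk)).
  rewrite rmorphN1 mulN1r opprK subrK => Yt'.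
  rewrite (eq_bigr (fun i : 'I_j => phi t * (phi (r i) * b i))) // => i _.
  by rewrite rmorphM mulrA.
rewrite -/y; have := lYX _ lYj; rewrite finset.in_set => /asboolP[r' /= Xr'].
rewrite -[y](subrK (phi (r j) * (\sum_(i < j) phi (r' i) * b i + b j))).
apply: XD; last exact: XZ.
have Dz : y - phi (r j) * (\sum_(i < j) phi (r' i) * b i + b j)
        = \sum_(i < j) phi (r i - r j * r' i) * b i.
  rewrite /y mulrDr opprD addrACA subrr addr0 mulr_sumr -sumrB.
  by apply: eq_bigr => i _; rewrite mulrA -rmorphM -mulrBl -rmorphB.
rewrite Dz; apply: (IH (fun i => r i - r j * r' i)); first exact: ltnW.
rewrite -Dz.
by apply: YB => //; apply: YZ; apply: XY.
Qed.

Lemma submodule_acc (F : (A -> Prop) -> Prop) :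
    (forall X, F X -> is_submodule X) -> (exists X, F X) ->
  exists2 X, F X &
    forall Y, F Y -> (forall x, X x -> Y x) -> forall x, Y x -> X x.
Proof.
move=> Fsub exF; have [|X FX maxX] := @ex_measure_max _ F (fun X => #|leads X|) k exF.
  by move=> X _; rewrite -[leqRHS]card_ord max_card.
exists X => // Y FY XY; apply: leads_sub => //; [exact: Fsub|exact: Fsub|].
by rewrite -(geq_leqif (subset_leqif_card (leadsS XY))) maxX.
Qed.

Lemma submodule_dcc (F : (A -> Prop) -> Prop) :
    (forall X, F X -> is_submodule X) -> (exists X, F X) ->
  exists2 X, F X &
    forall Y, F Y -> (forall x, Y x -> X x) -> forall x, X x -> Y x.
Proof.
move=> Fsub exF.
have [|X FX minX] := @ex_measure_max _ F (fun X => k - #|leads X|)%N k exF.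
  by move=> X _; rewrite leq_subr.
exists X => // Y FY YX; apply: leads_sub => //; [exact: Fsub|exact: Fsub|].
rewrite -(geq_leqif (subset_leqif_card (leadsS YX))).
have := minX _ FY; rewrite leq_sub2lE //.
by rewrite -[leqRHS]card_ord max_card.
Qed.

(** Nakayama's lemma with an explicit denominator in place of localization. The generators are
    eliminated from the last one down, and the product of the denominators met on the way stays
    outside [m] because [m] is prime. *)
Lemma nakayama (Y : A -> Prop) : Y 0 ->
    (forall x y, Y x -> Y y -> Y (x - y)) -> (forall r x, Y x -> Y (phi r * x)) ->
    (forall i, (i < k)%N -> exists r : nat -> R,
       (forall j, m (r j)) /\ Y (b i - \sum_(j < k) phi (r j) * b j)) ->
  exists2 s, ~ m s & forall i, (i < k)%N -> Y (phi s * b i).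
Proof.
move=> Y0 YB YZ gen.
have YD x z : Y x -> Y z -> Y (x + z).
  by move=> Yx Yz; rewrite -[z]opprK; apply: (YB) => //; rewrite -sub0r; apply: YB.
(* The induction needs relations with denominators, since eliminating [b l] multiplies the other
   relations by [s1]. *)
have {gen}: forall i, (i < k)%N -> exists (s : R) (r : nat -> R),
    [/\ ~ m s, forall j, m (r j) &
        Y (phi s * b i - \sum_(j < k) phi (r j) * b j)].
  by move=> i /gen[r [mr Yr]]; exists 1, r; split; rewrite ?rmorph1 ?mul1r.
elim: k => [|l IH] gen; first by exists 1.
have [s [r [nms mr Ysr]]] := gen l (ltnSn l).
pose s1 := s - r l.
have nms1 : ~ m s1 by move=> ms1; apply: nms; rewrite -(subrK (r l) s); apply: mD.
have Yl : Y (phi s1 * b l - \sum_(j < l) phi (r j) * b j).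
  by move: Ysr; rewrite big_ord_recr /= rmorphB mulrBl opprD addrA addrAC.
clearbody s1; have [|s' nms' Ys'] := IH.
  move=> i ltil; have [si [ri [nmsi mri Yi]]] := gen i (ltnW ltil).
  exists (s1 * si), (fun j => s1 * ri j + ri l * r j); split.
  - exact: max_prime.
  - by move=> j; apply: mD; [apply: mM|rewrite mulrC; apply: mM].
  have := YD _ _ (YZ s1 _ Yi) (YZ (ri l) _ Yl).
  rewrite big_ord_recr /= !mulrBr !mulrDr !mulrA -!rmorphM.
  rewrite [ri l * s1]mulrC opprD addrA addrA subrK => h.
  rewrite -[X in Y X]addr0.
  apply: (eq_ind _ Y h); rewrite addr0 -!addrA; congr (_ + _).
  rewrite !mulr_sumr -opprD -big_split /=; congr (- _); apply: eq_bigr => j _.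
  by rewrite (rmorphD phi) mulrDl !rmorphM !mulrA.
exists (s1 * s'); first exact: max_prime.
move=> i; rewrite ltnS leq_eqVlt => /orP[/eqP->|ltil]; last first.
  by rewrite rmorphM -mulrA; apply/YZ/Ys'.
rewrite mulrC rmorphM -mulrA -[X in _ * X](subrK (\sum_(j < l) phi (r j) * b j)).
rewrite mulrDr; apply: (YD); first exact: YZ.
rewrite mulr_sumr; elim/big_rec: _ => // j x _ Yx; apply: YD => //.
by rewrite mulrA -rmorphM mulrC rmorphM -mulrA; apply/YZ/Ys'.
Qed.

(** * Right ideals of [B] modulo [mB] *)

Definition mB x := exists2 r : nat -> R,
  forall i, m (r i) & x = \sum_(i < k) phi (r i) * b i.

Definition right_ideal X :=
  is_submodule X /\ (forall x c, X x -> B c -> X (x * c)).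

Definition bilateral X := right_ideal X /\ (forall c x, B c -> X x -> X (c * x)).

Lemma mB_sub X : is_submodule X -> forall x, mB x -> X x.
Proof.
move=> [X0 XsB Xm XB XZ] x [r mr ->].
apply: big_ind => //= [y z Xy Xz|i _]; last exact: Xm.
by rewrite -[z]opprK; apply: (XB) => //; rewrite -sub0r; apply: XB.
Qed.

Lemma msum (I : finType) (F : I -> R) : (forall i, m (F i)) -> m (\sum_i F i).
Proof. by move=> mF; elim/big_rec: _ => // i x _; apply: mD. Qed.

Lemma mB_span (r : nat -> R) (z : nat -> A) :
  (forall i, m (r i)) -> (forall i, (i < k)%N -> B (z i)) ->
  mB (\sum_(i < k) phi (r i) * z i).
Proof.
move=> mr Bz.
have /choice[t Dt] : forall i : 'I_k, exists t : nat -> R,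
    z i = \sum_(j < k) phi (t j) * b j by move=> i; apply/Bspan/Bz.
exists (fun j => \sum_(i < k) r i * t i j).
  by move=> j; apply: msum => i; rewrite mulrC; apply: mM.
transitivity (\sum_(i < k) \sum_(j < k) phi (r i * t i j) * b j).
  apply: eq_bigr => i _; rewrite Dt mulr_sumr; apply: eq_bigr => j _.
  by rewrite rmorphM mulrA.
rewrite exchange_big; apply: eq_bigr => j _.
by rewrite rmorph_sum mulr_suml.
Qed.

Lemma mB_bilateral : bilateral mB.
Proof.
split; first split; first split.
- by exists (fun=> 0) => //; rewrite big1 // => i _; rewrite rmorph0 mul0r.
- by move=> x [r _ ->]; apply: Bsum => i; apply/Bphi/Bb.
- move=> r i mr ltik; exists (fun j => if j == i then r else 0).
    by move=> j; case: ifP.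
  rewrite (bigD1 (Ordinal ltik)) //= eqxx big1 ?addr0 // => j.
  by rewrite -val_eqE /= => /negPf->; rewrite rmorph0 mul0r.
- move=> x y [r mr ->] [s ms ->]; exists (fun i => r i - s i).
    by move=> i; apply: mD => //; apply: maxN.
  by rewrite -sumrB; apply: eq_bigr => i _; rewrite rmorphB mulrBl.
- move=> r x [s ms ->]; exists (fun i => r * s i); first by move=> i; apply: mM.
  by rewrite mulr_sumr; apply: eq_bigr => i _; rewrite rmorphM mulrA.
- move=> x c [r mr ->] Bc; rewrite mulr_suml.
  rewrite (eq_bigr (fun i : 'I_k => phi (r i) * (b i * c))) => [|i _].
    by apply: (mB_span (z := fun i => b i * c)) => // i ltik; apply: BM (Bb _) _.
  by rewrite mulrA.
move=> c x Bc [r mr ->]; rewrite mulr_sumr.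
rewrite (eq_bigr (fun i : 'I_k => phi (r i) * (c * b i))) => [|i _].
  by apply: (mB_span (z := fun i => c * b i)) => // i ltik; apply: BM (Bb _).
by rewrite mulrA -phiC mulrA.
Qed.

Section RightIdeals.
Variable X : A -> Prop.
Hypothesis rX : right_ideal X.

Lemma rid0 : X 0. Proof. by case: rX => [[]]. Qed.
Lemma ridS x : X x -> B x. Proof. by case: rX => [[_ + _ _ _] _]; apply. Qed.
Lemma ridB x y : X x -> X y -> X (x - y).
Proof. by case: rX => [[_ _ _ + _] _]; apply. Qed.
Lemma ridN x : X x -> X (- x).
Proof. by rewrite -sub0r; apply: ridB rid0. Qed.
Lemma ridD x y : X x -> X y -> X (x + y).
Proof. by move=> Xx Xy; rewrite -[y]opprK; apply/ridB/ridN. Qed.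
Lemma ridM x c : X x -> B c -> X (x * c). Proof. by case: rX => _; apply. Qed.
Lemma rid_subr x y : X (x - y) -> X y -> X x.
Proof. by move=> Xxy Xy; rewrite -(subrK y x); apply: ridD. Qed.
Lemma rid_mB x : mB x -> X x. Proof. by apply: mB_sub; case: rX. Qed.
End RightIdeals.

Let B_phi1 r : B (phi r).
Proof. by rewrite -[phi r]mulr1; apply: Bphi. Qed.

Lemma right_ideal_intro (X : A -> Prop) : X 0 -> (forall x, X x -> B x) ->
    (forall x, mB x -> X x) -> (forall x y, X x -> X y -> X (x - y)) ->
    (forall x c, X x -> B c -> X (x * c)) -> right_ideal X.
Proof.
move=> X0 XsB Xm XB XM; split=> //; split=> // [r i mr ltik|r x Xx].
  by apply: Xm; have [[[_ _ mBm _ _] _] _] := mB_bilateral; apply: mBm.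
by rewrite phiC; apply/XM/B_phi1.
Qed.

(** The right ideals of elements killed by [y ^+ n] modulo [P] increase with [n], hence
    stabilize. *)
Lemma acc_pow (P : A -> Prop) (y : A) : bilateral P -> B y ->
  exists n, forall x, B x -> P (y ^+ n.+1 * x) -> P (y ^+ n * x).
Proof.
move=> [rP PMl] By.
pose F X := exists n, X = (fun x => B x /\ P (y ^+ n * x)).
have Fsub X : F X -> is_submodule X.
  move=> [n ->]; suff [] : right_ideal (fun x => B x /\ P (y ^+ n * x)) by [].
  apply: right_ideal_intro => [|x []|x mx|x z [Bx Px] [Bz Pz]|x c [Bx Px] Bc] //.
  - by rewrite mulr0; split; [apply: B0 | apply: rid0 rP].
  - by split; [apply: ridS rP _ (rid_mB rP mx)|apply: PMl; [apply: BX | apply: rid_mB mx]].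
  - by rewrite mulrBr; split; [apply: BB | apply: ridB rP _ _ _ _].
  - by rewrite mulrA; split; [apply: BM | apply: ridM].
have [|_ [n ->] maxn] := submodule_acc Fsub; first by eexists; exists 0%N.
exists n => x Bx Px.
have [] // := maxn (fun x => B x /\ P (y ^+ n.+1 * x)) _ _ x.
  by exists n.+1.
by move=> z [Bz Pz]; split=> //; rewrite exprS -mulrA; apply: PMl.
Qed.

(** The right ideals y^n B + P decrease with [n], hence stabilize. *)
Lemma dcc_pow (P : A -> Prop) (y : A) : bilateral P -> B y ->
  exists n z, B z /\ P (y ^+ n * (1 - y * z)).
Proof.
move=> [rP PMl] By.
pose X n x := B x /\ exists2 t, B t & P (x - y ^+ n * t).
have Fsub Y : (exists n, Y = X n) -> is_submodule Y.
  move=> [n ->]; suff [] : right_ideal (X n) by [].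
  apply: right_ideal_intro => [|x []|x mx|x x'|x c] //.
  - split; [exact: B0|exists 0; [exact: B0|]].
    by rewrite mulr0 subrr; apply: rid0 rP.
  - split; first by apply: ridS rP _ (rid_mB rP mx).
    by exists 0; [apply: B0 | rewrite mulr0 subr0; apply: rid_mB mx].
  - move=> [Bx [t Bt Pt]] [Bx' [t' Bt' Pt']]; split; first exact: BB.
    exists (t - t'); first exact: BB.
    by rewrite mulrBr opprD addrACA -opprD; apply: ridB.
  - move=> [Bx [t Bt Pt]] Bc; split; first exact: BM.
    by exists (t * c); [apply: BM | rewrite mulrA -mulrBl; apply: ridM].
have [|_ [n ->] minn] := submodule_dcc Fsub; first by eexists; exists 0%N.
have [|||_ [z Bz Pz]] := minn (X n.+1) _ _ (y ^+ n); first by exists n.+1.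
- move=> x [Bx [t Bt Pt]]; split=> //; exists (y * t); first exact: BM.
  by rewrite mulrA -exprSr.
- split; first exact: BX.
  by exists 1; rewrite // mulr1 subrr; apply: rid0.
by exists n, z; rewrite mulrBr mulr1 mulrA -exprSr.
Qed.

(** [P] plays the role of the Jacobson radical: it is maximal among the two-sided ideals all of
    whose [1 - p] are right invertible modulo [mB]. Adjoining a right ideal with square in [P] keeps
    this property, because (1 - p)(1 + p) = 1 - p^2 and p^2 falls into [P]. *)
Lemma radical_exists : exists P, [/\ bilateral P,
    forall p, P p -> exists2 z, B z & mB ((1 - p) * z - 1) &
    forall X, right_ideal X -> (forall x y, X x -> X y -> P (x * y)) ->
      forall x, X x -> P x].
Proof.
pose F P := bilateral P /\
  forall p, P p -> exists2 z, B z & mB ((1 - p) * z - 1).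
have [||P [bP radP] maxP] := @submodule_acc F; first by move=> X [[[]]].
  exists mB; split=> [|p mp]; first exact: mB_bilateral.
  exists 1; rewrite // mulr1 addrAC subrr sub0r.
  by apply: ridN mp; case: mB_bilateral.
have [rP PMl] := bP.
exists P; split=> // X rX XX x Xx.
(* This is P + BX, encoded as the least additive subgroup containing both; it is a two-sided ideal
   with square in [P]. *)
pose P' u := forall Y : A -> Prop, Y 0 -> (forall a c, Y a -> Y c -> Y (a - c)) ->
  (forall p, P p -> Y p) -> (forall c x, B c -> X x -> Y (c * x)) -> Y u.
have P'B u : P' u -> B u.
  move=> /(_ B); apply=> [|//||c z Bc Xz]; [exact: B0|by move=> p; apply: ridS|].
  by apply: BM => //; apply: ridS Xz.
have PP' p : P p -> P' p by move=> Pp Y _ _ + _; apply.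
have XP' z : X z -> P' z by move=> Xz Y _ _ _ /(_ 1 z B1 Xz); rewrite mul1r.
have XP'P z v : X z -> P' v -> P (z * v).
  move=> Xz /(_ (fun v => P (z * v))); apply=> [|a c Pa Pc|p|c t Bc Xt].
  - by rewrite mulr0; apply: rid0.
  - by rewrite mulrBr; apply: ridB.
  - by move=> Pp; apply: PMl => //; apply: ridS Xz.
  - by rewrite mulrA; apply: XX => //; apply: ridM.
have P'P'P u v : P' u -> P' v -> P (u * v).
  move=> /(_ (fun u => P (u * v))) P'u P'v; apply: P'u => [|a c Pa Pc|p Pp|c t Bc Xt].
  - by rewrite mul0r; apply: rid0.
  - by rewrite mulrBl; apply: ridB.
  - by apply: ridM => //; apply: P'B.
  - by rewrite -mulrA; apply: PMl => //; apply: XP'P.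
apply: (maxP P') (XP' _ Xx) => //; split.
  split=> [|c u Bc P'u Y Y0 YB YP YX].
    apply: right_ideal_intro => // [z mz|u v P'u P'v Y Y0 YB YP YX|].
    - by apply: PP'; apply: rid_mB mz.
    - by apply: (YB); [apply: P'u|apply: P'v].
    - move=> u c P'u Bc Y Y0 YB YP YX; apply: (P'u (fun u => Y (u * c))).
      + by rewrite mul0r.
      + by move=> a d Ya Yd; rewrite mulrBl; apply: YB.
      + by move=> p Pp; apply: YP; apply: ridM.
      + by move=> d z Bd Xz; rewrite -mulrA; apply: YX => //; apply: ridM.
  apply: (P'u (fun u => Y (c * u))).
  - by rewrite mulr0.
  - by move=> a d Ya Yd; rewrite mulrBr; apply: YB.
  - by move=> p Pp; apply: YP; apply: PMl.
  - by move=> d z Bd Xz; rewrite mulrA; apply: YX => //; apply: BM.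
move=> p P'p; have [z Bz mz] := radP _ (P'P'P _ _ P'p P'p).
exists ((1 + p) * z); first by apply: BM => //; apply/BD/P'B.
apply: (eq_ind _ mB mz); congr (_ - _); rewrite mulrA; congr (_ * _).
by rewrite mulrBl !mulrDr !mul1r mulr1 opprD addrA addrK.
Qed.

(** * Stable rank one modulo a semiprime ideal *)

Section Pivot.
Variable P : A -> Prop.
Hypothesis bP : bilateral P.
Hypothesis P_semiprime : forall X, right_ideal X ->
  (forall x y, X x -> X y -> P (x * y)) -> forall x, X x -> P x.

Let rP : right_ideal P. Proof. by case: bP. Qed.
Let PMl c x : B c -> P x -> P (c * x). Proof. by case: bP => _; apply. Qed.
Let PMr x c : P x -> B c -> P (x * c). Proof. exact: ridM. Qed.
Let PS x : P x -> B x. Proof. exact: ridS. Qed.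
Let P0 : P 0. Proof. exact: rid0. Qed.
Let PB x y : P x -> P y -> P (x - y). Proof. exact: ridB. Qed.
Let PD x y : P x -> P y -> P (x + y). Proof. exact: ridD. Qed.
Let PN x : P x -> P (- x). Proof. exact: ridN. Qed.

(** Left multiplication by [y] modulo [P] has a nonzero kernel, as otherwise the powers of [y] in
    [dcc_pow] could be cancelled to give a right inverse. A minimal right ideal [M] inside the
    kernel is not square-zero, so it contains an idempotent by Brauer's lemma. *)
Lemma kernel_idempotent (y : A) : B y -> ~ (exists2 z, B z & P (1 - y * z)) ->
  exists eps, [/\ B eps, ~ P eps, P (eps * eps - eps) & P (y * eps)].
Proof.
move=> By ny.
pose F M := [/\ right_ideal M, forall x, P x -> M x,
  forall x, M x -> P (y * x) & exists2 x, M x & ~ P x].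
have [||M [rM PM MK [x0 Mx0 nPx0]] minM] := @submodule_dcc F.
- by move=> M [[]].
- exists (fun x => B x /\ P (y * x)); split=> [|x Px|x []|] //.
  + apply: right_ideal_intro => [|x []|x mx|x z [Bx Px] [Bz Pz]|x c [Bx Px] Bc] //.
    * by rewrite mulr0; split; [apply: B0|].
    * by have Px : P x by [apply: rid_mB mx]; split; [apply: PS|apply: PMl].
    * by rewrite mulrBr; split; [apply: BB|apply: PB].
    * by rewrite mulrA; split; [apply: BM|apply: PMr].
  + by split; [apply: PS|apply: PMl].
  apply: contrapT => inj; apply: ny.
  have [n [z [Bz]]] := dcc_pow bP By; elim: n => [|n IH].
    by rewrite mul1r; exists z.
  rewrite exprS -mulrA => Pyn; apply: IH; apply: contrapT => nPn; apply: inj.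
  by exists (y ^+ n * (1 - y * z)) => //; split=> //; apply: BM (BX _ _) (BB _ (BM _ _)).
have [q [q' [Mq Mq' nPqq]]] : exists q q', [/\ M q, M q' & ~ P (q * q')].
  apply: contrapT => nq; apply: nPx0; apply: (P_semiprime rM) => // x z Mx Mz.
  by apply: contrapT => nP; apply: nq; exists x, z.
have Bq := ridS rM Mq; have Bq' := ridS rM Mq'.
(* By minimality q M + P is all of [M], so [q] equals [q * eps] modulo [P] for some [eps] in [M]. *)
have [|||Bq1 [eps Meps Peps]] := minM (fun x => B x /\ exists2 t, M t & P (x - q * t)) _ _ q.
- split.
  + apply: right_ideal_intro => [|x []|x mx|x z|x c] //.
    * by split; [exact: B0|exists 0; [exact: rid0 rM|rewrite mulr0 subrr]].
    * have Px : P x by apply: rid_mB mx.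
      split; first exact: PS.
      by exists 0; [exact: rid0 rM|rewrite mulr0 subr0].
    * move=> [Bx [t Mt Pt]] [Bz [t' Mt' Pt']]; split; first exact: BB.
      exists (t - t'); first exact: ridB rM _ _ Mt Mt'.
      by rewrite mulrBr opprD addrACA -opprD; apply: PB.
    * move=> [Bx [t Mt Pt]] Bc; split; first exact: BM.
      by exists (t * c); [apply: ridM rM _ _ Mt Bc|rewrite mulrA -mulrBl; apply: PMr].
  + move=> x Px; split; first exact: PS.
    by exists 0; [exact: rid0 rM|rewrite mulr0 subr0].
  + move=> x [Bx [t Mt Pt]]; rewrite -(subrK (q * t) x) mulrDr; apply: PD.
      exact: PMl.
    by rewrite mulrA; apply: PMr (MK _ Mq) (ridS rM Mt).
  + exists (q * q') => //; split; first exact: BM.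
    by exists q'; rewrite ?subrr.
- move=> x [Bx [t Mt Pt]]; apply: (rid_subr rM) (PM _ Pt) _.
  by apply: (ridM rM) => //; apply: ridS Mt.
- by [].
have Beps := ridS rM Meps.
exists eps; split=> //; last exact: MK.
- move=> Pe; apply: nPqq; apply: PMr => //.
  by rewrite -(subrK (q * eps) q); apply: PD => //; apply: PMl.
(* The elements of [M] killed by [q] form a right ideal containing [eps * eps - eps]. Were the
   latter outside [P], minimality would make this ideal all of [M] and put [q * q'] in [P]. *)
apply: contrapT => nPe; apply: nPqq.
have [|||] // := minM (fun x => M x /\ P (q * x)) _ _ q'; last first.
  by move=> x [].
split=> [||x []|].
- apply: right_ideal_intro => [|x []|x mx|x z [Mx Px] [Mz Pz]|x c [Mx Px] Bc].
  + by split; [apply: rid0 rM|rewrite mulr0].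
  + by move=> Mx _; apply: ridS Mx.
  + have Px : P x by apply: rid_mB mx.
    by split; [apply: PM|apply: PMl].
  + by rewrite mulrBr; split; [apply: ridB rM _ _ Mx Mz|apply: PB].
  + by rewrite mulrA; split; [apply: ridM rM _ _ Mx Bc|apply: PMr].
- by move=> x Px; split; [apply: PM|apply: PMl].
- by move=> Mx _; apply: MK.
exists (eps * eps - eps) => //; split.
  by apply: (ridB rM) => //; apply: (ridM rM).
rewrite mulrBr mulrA -mulrBl; apply: PMr => //.
by rewrite -opprB; apply: PN.
Qed.
(** Bass's stable rank one condition for [a] and [1 - a * w], which together generate the unit right
    ideal. Take [c] such that the right ideal of [y] is maximal modulo [P]; if it were proper, an
    idempotent [eps] killed by [y] would allow enlarging it by passing to [c + d * eps]. *)
Lemma right_unit_mod (a w : A) : B a -> B w ->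
  exists c z, [/\ B c, B z & P (1 - (a + (1 - a * w) * c) * z)].
Proof.
move=> Ba Bw; set u := 1 - a * w.
have Bu : B u by apply: BB => //; apply: BM.
pose yc c := a + u * c.
have Byc c : B c -> B (yc c) by move=> Bc; apply/BD/BM.
pose X c x := B x /\ exists2 t, B t & P (x - yc c * t).
have rX c : B c -> right_ideal (X c).
  move=> Bc; apply: right_ideal_intro => [|x []|x mx|x z|x d] //.
  - by split; [exact: B0|exists 0; [exact: B0|rewrite mulr0 subrr]].
  - have Px : P x by apply: rid_mB mx.
    by split; [exact: PS|exists 0; [exact: B0|rewrite mulr0 subr0]].
  - move=> [Bx [t Bt Pt]] [Bz [t' Bt' Pt']]; split; first exact: BB.
    exists (t - t'); first exact: BB.
    by rewrite mulrBr opprD addrACA -opprD; apply: PB.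
  - move=> [Bx [t Bt Pt]] Bd; split; first exact: BM.
    by exists (t * d); [apply: BM|rewrite mulrA -mulrBl; apply: PMr].
have [||_ [c Bc ->] maxc] := @submodule_acc (fun Y => exists2 c, B c & Y = X c).
- by move=> _ [c /rX[sX _] ->].
- by exists (X 0), 0 => //; apply: B0.
exists c; apply: contrapT => nz.
have ny : ~ exists2 z, B z & P (1 - yc c * z).
  by move=> [z Bz Pz]; apply: nz; exists z.
have [eps [Be nPe Pee Pye]] := kernel_idempotent (Byc _ Bc) ny.
set y := yc c in Pye ny; have By : B y := Byc _ Bc.
(* If no [d] works, every [d * eps] lies in y B eps + P. Iterating puts [eps] in y^n B eps + P for
   all [n], and since the kernels of the powers of [y] stabilize, [eps] falls into [P]. *)
have [d [Bd nXd]] : exists d, B d /\ ~ X c (u * d * eps).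
  apply: contrapT => nd; apply: nPe.
  have Xue d : B d -> X c (u * d * eps).
    by move=> Bd; apply: contrapT => nX; apply: nd; exists d.
  have step d : B d -> exists2 t, B t & P (d * eps - y * (t * eps)).
    move=> Bd; have [|_ [t Bt Pt]] := Xue ((1 - c * w) * d).
      by apply: BM => //; apply: BB => //; apply: BM.
    have Dd : u * ((1 - c * w) * d) = d - y * (w * d).
      by rewrite /y /yc /u; ncring.
    exists (w * d * eps + t); first by apply: BD => //; do 2!apply: BM => //.
    have -> : d * eps - y * ((w * d * eps + t) * eps)
            = (u * ((1 - c * w) * d) * eps - y * t) * eps - d * (eps * eps - eps).
      by rewrite Dd; ncring.
    by apply: PB; [apply: PMr | apply: PMl].
  have iter n : exists2 t, B t & P (eps - y ^+ n * (t * eps)).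
    elim: n => [|n [t Bt Pt]].
      by exists 1; rewrite // !mul1r subrr.
    have [t' Bt' Pt'] := step t Bt; exists t' => //.
    have -> : eps - y ^+ n.+1 * (t' * eps) = eps - y ^+ n * (t * eps)
               + y ^+ n * (t * eps - y * (t' * eps)) by rewrite exprSr; ncring.
    by apply: PD => //; apply: PMl => //; apply: BX.
  have [n kern] := acc_pow bP By.
  have [t Bt Pt] := iter n.
  apply: (rid_subr rP Pt).
  apply: kern; first exact: BM.
  have -> : y ^+ n.+1 * (t * eps) = y * eps - y * (eps - y ^+ n * (t * eps)).
    by rewrite exprS; ncring.
  by apply: PB => //; apply: PMl.
(* Modulo [P], multiplying [y2] by [1 - eps] gives [y] and by [eps] gives [u * d * eps], so the
   right ideal of [y2] contains both. *)
pose y2 := yc (c + d * eps).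
have Bc2 : B (c + d * eps) by apply/BD/BM.
have Dy2 : y2 = y + u * d * eps by rewrite /y2 /y /yc mulrDr addrA !mulrA.
have Xy : X (c + d * eps) y.
  split=> //; exists (1 - eps); first exact: BB.
  have -> : y - yc (c + d * eps) * (1 - eps)
          = y * eps + u * d * (eps * eps - eps).
    by rewrite -/y2 Dy2; ncring.
  by apply: PD => //; apply: PMl => //; apply: BM.
have [|||_ [t Bt Pt]] := maxc (X (c + d * eps)) _ _ (u * d * eps).
- by exists (c + d * eps).
- move=> x [Bx [t Bt Pt]].
  apply: (rid_subr (rX _ Bc2) (y := y * t)); last exact: (ridM (rX _ Bc2)).
  split; first by apply: BB => //; apply: BM.
  by exists 0; [exact: B0|rewrite mulr0 subr0].
- split; first by do 2!apply: BM => //.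
  exists eps => //; have -> : u * d * eps - yc (c + d * eps) * eps
                            = - (y * eps) - u * d * (eps * eps - eps).
    by rewrite -/y2 Dy2; ncring.
  by apply: PB; [apply: PN|apply: PMl => //; apply: BM].
by apply: nXd; split; [do 2!apply: BM => //|exists t].
Qed.
End Pivot.

(** B/P is Dedekind finite. For q = 1 - z y one has q = y^n z^n q modulo [P], while y^(n+1) z^n q =
    y q = 0; where the kernels of the powers of [y] have stabilized, this puts [q] in [P]. *)
Lemma one_sided_unit_mod (P : A -> Prop) (y z : A) :
  bilateral P -> B y -> B z -> P (1 - y * z) -> P (1 - z * y).
Proof.
move=> bP By Bz Pyz; have [rP PMl] := bP.
have [n kern] := acc_pow bP By.
have BZ j : B (1 - y ^+ j * z ^+ j) by apply: BB => //; apply: BM; apply: BX.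
have Pyzn j : P (1 - y ^+ j * z ^+ j).
  elim: j => [|j IH]; first by rewrite mulr1 subrr; apply: rid0 rP.
  have -> : 1 - y ^+ j.+1 * z ^+ j.+1
          = (1 - y * z) + y * (1 - y ^+ j * z ^+ j) * z.
    by rewrite exprS exprSr; ncring.
  by apply: (ridD rP) => //; apply: (ridM rP) => //; apply: PMl.
set q := 1 - z * y; have Bq : B q by apply: BB => //; apply: BM.
apply: (rid_subr rP (y := y ^+ n * (z ^+ n * q))).
  have -> : q - y ^+ n * (z ^+ n * q) = (1 - y ^+ n * z ^+ n) * q by ncring.
  exact: (ridM rP).
apply: kern; first by apply: BM => //; apply: BX.
have -> : y ^+ n.+1 * (z ^+ n * q)
        = (1 - y * z) * y - y * ((1 - y ^+ n * z ^+ n) * q).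
  by rewrite exprS /q; ncring.
apply: (ridB rP); first exact: (ridM rP).
by apply: PMl => //; apply: (ridM rP).
Qed.

(** As [u] lies in [mB], so do [b i * u] and [u * b i]; hence each [b i] lies in Y + mB and
    [nakayama] applies. Expanding 1 in the [b i] then gives [phi s]. *)
Lemma submodule_unit (Y : A -> Prop) (u : A) : Y 0 ->
    (forall x y, Y x -> Y y -> Y (x - y)) -> (forall r x, Y x -> Y (phi r * x)) ->
    mB u -> (forall i, (i < k)%N -> Y (b i - b i * u) \/ Y (b i - u * b i)) ->
  exists2 s, ~ m s & Y (phi s).
Proof.
move=> Y0 YB YZ mu Yb; have [[rmB mBr] mBl] := mB_bilateral.
have [|s nms Ys] := @nakayama Y Y0 YB YZ; last first.
- exists s => //; have [r D1] := Bspan B1.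
  rewrite -[phi s]mulr1 {}D1 mulr_sumr; elim/big_ind: _ => // [x z Yx Yz|i _].
    by rewrite -[z]opprK; apply: (YB) => //; rewrite -sub0r; apply: YB.
  by rewrite mulrA -rmorphM mulrC rmorphM -mulrA; apply/YZ/Ys.
move=> i ltik; have [Yi|Yi] := Yb i ltik.
  by have [r mr Dr] := mBl _ _ (Bb ltik) mu; exists r; rewrite -Dr.
by have [r mr Dr] := mBr _ _ mu (Bb ltik); exists r; rewrite -Dr.
Qed.

(** Applying [submodule_unit] to yA and to Ay gives a right and a left inverse of [y] up to
    denominators, which agree after passing to the product of the denominators. *)
Lemma unit_mod_unit_at (y z : A) : B y -> B z -> mB (1 - y * z) ->
  exists s x, [/\ ~ m s, y * x = phi s & x * y = phi s].
Proof.
move=> By Bz myz.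
have mzy := one_sided_unit_mod mB_bilateral By Bz myz.
have [||||s nms [x Dx]] := @submodule_unit (fun u => exists t, u = y * t) _ _ _ _ myz.
- by exists 0; rewrite mulr0.
- by move=> _ _ [t ->] [t' ->]; exists (t - t'); rewrite mulrBr.
- by move=> r _ [t ->]; exists (phi r * t); rewrite !mulrA phiC.
- by move=> i _; right; exists (z * b i); ncring.
have [||||s' nms' [x' Dx']] := @submodule_unit (fun u => exists t, u = t * y) _ _ _ _ mzy.
- by exists 0; rewrite mul0r.
- by move=> _ _ [t ->] [t' ->]; exists (t - t'); rewrite mulrBl.
- by move=> r _ [t ->]; exists (phi r * t); rewrite mulrA.
- by move=> i _; left; exists (b i * z); ncring.
exists (s * s'), (x * phi s'); split; first exact: max_prime.
  by rewrite mulrA -Dx rmorphM.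
have -> : x * phi s' = phi s * x' by rewrite -phiC Dx' -mulrA -Dx phiC.
by rewrite -mulrA -Dx' rmorphM.
Qed.

(** Stable rank one holds modulo the radical; a right inverse there is corrected to one modulo [mB]
    and then to a two-sided inverse up to a denominator outside [m]. *)
Lemma unit_at (a w : A) : B a -> B w ->
  exists c s x, let y := a + (1 - a * w) * c in
    [/\ ~ m s, y * x = phi s & x * y = phi s].
Proof.
move=> Ba Bw; have [P [bP radP semiP]] := radical_exists.
have [c [z [Bc Bz Pyz]]] := right_unit_mod bP semiP Ba Bw.
set y := a + _ in Pyz.
have By : B y by apply: BD => //; apply: (BM) => //; apply: (BB) => //; apply: BM.
have [z' Bz' mz'] := radP _ Pyz; exists c.
have [||s [x Hx]] := @unit_mod_unit_at y (z * z') By; last by exists s, x.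
  exact: BM.
have [rmB _] := mB_bilateral; rewrite -opprB; apply: (ridN rmB).
by rewrite mulrA; rewrite subKr in mz'.
Qed.

End LocalAlgebra.

Lemma maximal_ideal (R : comPzRingType) (Q : R -> Prop) :
    Q 0 -> (forall r s, Q r -> Q s -> Q (r + s)) ->
    (forall r s, Q s -> Q (r * s)) -> ~ Q 1 ->
  exists m : R -> Prop, (forall r, Q r -> m r) /\
    [/\ m 0, forall r s, m r -> m s -> m (r + s), forall r s, m s -> m (r * s),
        ~ m 1 & forall r, ~ m r -> exists t, m (1 - t * r)].
Proof.
move=> Q0 QD QM Q1.
pose ideal (X : R -> Prop) := [/\ forall r s, X r -> X s -> X (r + s),
  forall r s, X s -> X (r * s) & ~ X 1].
(* [Q] is joined to [X] rather than required inside it, so that the union of the empty chain also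
   satisfies [P]. *)
pose P (X : set R) := ideal (fun r => Q r \/ X r).
have [F FP Ftot|X [PX maxX]] := @Zorn_bigcup R P.
  split=> [r s|r s [Qs|[X FX Xs]]|[|[X FX X1]]] //; last first.
  - by have [_ _] := FP X FX; apply; right.
  - have [_ XM _] := FP X FX; have [|Qrs|Xrs] := XM r s; first by right.
      by left.
    by right; exists X.
  - by left; apply: QM.
  have XD X : F X -> forall r s, Q r \/ X r -> Q s \/ X s ->
      Q (r + s) \/ (\bigcup_(X in F) X)%classic (r + s).
    move=> FX r' s' Xr Xs; have [XD _ _] := FP X FX.
    by have [|Xrs] := XD _ _ Xr Xs; [left|right; exists X].
  move=> [Qr|[X FX Xr]] [Qs|[Y FY Ys]].
  - by left; apply: QD.
  - by apply: (XD Y) => //; [left|right].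
  - by apply: (XD X) => //; [right|left].
  - have [XY|YX] := Ftot X Y FX FY.
      by apply: (XD Y) => //; right => //; apply: XY.
    by apply: (XD X) => //; right => //; apply: YX.
have [XD XM X1] := PX.
exists (fun r => Q r \/ X r); split; first by left.
split=> //; first by left.
move=> r nXr; apply: contrapT => nt.
pose Y u := exists s t, (Q s \/ X s) /\ u = s + t * r.
have XY u : Q u \/ X u -> Y u by move=> Xu; exists u, 0; rewrite mul0r addr0.
apply: (maxX Y).
  split; first by move=> u Xu; apply: XY; right.
  move=> YX; apply: nXr; right; apply: YX.
  by exists 0, 1; rewrite add0r mul1r; split; [left|].
have QY u : Q u \/ Y u -> Y u by case=> // Qu; apply: XY; left.
split=> [u v /QY[s [t [Xs ->]]] /QY[s' [t' [Xs' ->]]]|u v /QY[s [t [Xs ->]]]|].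
- right; exists (s + s'), (t + t'); split; first exact: XD.
  by rewrite mulrDl addrACA.
- by right; exists (u * s), (u * t); rewrite mulrDr mulrA; split=> //; apply: XM.
move=> /QY[s [t [Xs D1]]]; apply: nt; exists t; rewrite D1 addrK.
exact: Xs.
Qed.

(* Only one element of A at a time has to be made invertible at a maximal
   ideal, which is why this replaces localization. *)
Theorem local_global (R : comPzRingType) (A : pzRingType)
    (phi : {rmorphism R -> A}) (phiC : forall r a, phi r * a = a * phi r)
    (qfA : quasi_finite phi) (Q : R -> Prop) (a w : A) :
    Q 0 -> (forall r s, Q r -> Q s -> Q (r + s)) ->
    (forall r s, Q s -> Q (r * s)) ->
    (forall c s x, let y := a + (1 - a * w) * c in
       y * x = phi s -> x * y = phi s -> exists N, Q (s ^+ N)) ->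
  Q 1.
Proof.
move=> Q0 QD QM Qloc; apply: contrapT => Q1.
have [m [Qm [m0 mD mM m1 m_max]]] := maximal_ideal Q0 QD QM Q1.
have [T [le [B [[[_] _ _ dirT] leB subB finB covB]]]] := qfA.
have [i Bia] : exists i, B i a.
  by have : setT a by []; rewrite -covB => -[i _ Bia]; exists i.
have [j Bjw] : exists j, B j w.
  by have : setT w by []; rewrite -covB => -[j _ Bjw]; exists j.
have [l [leil lejl]] := dirT i j.
have [B1 BB BM Bphi] := subB l.
have [k [b [Bb Bspan]]] := finB l.
(* The generators are reindexed by [nat], with value 0 from [k] on. *)
pose b' i' := if insub i' is Some i'' then b i'' else 0.
have Bb' i' : (i' < k)%N -> B l (b' i') by move=> lti; rewrite /b' insubT.
have Bspan' x : B l x -> exists r : nat -> R, x = \sum_(i' < k) phi (r i') * b' i'.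
  move=> /Bspan[r ->]; exists (fun i' => if insub i' is Some i'' then r i'' else 0).
  by apply: eq_bigr => i' _; rewrite /b' valK.
have [c [s [x [nms yx xy]]]] := unit_at phiC m0 mD mM m1 m_max B1 BB BM Bphi Bb'
  Bspan' (leB _ _ leil _ Bia) (leB _ _ lejl _ Bjw).
have [N QsN] := Qloc _ _ _ yx xy.
suff: ~ m (s ^+ N) by apply; apply: Qm.
elim: N {QsN} => [|N IH]; first by rewrite expr0.
by rewrite exprS; apply: max_prime mD mM m_max _ _ nms IH.
Qed.

(** * Elementary matrices and decomposition of unipotents *)

Section GroupLemmas.
Variable G : groupType.
Implicit Types (H K : set G) (x y z : G).
Local Open Scope group_scope.

Lemma comm_1l x : comm 1 x = 1 :> G.
Proof. by rewrite /comm mul1g invg1 mulg1 mulgV. Qed.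

Lemma comm_1r x : comm x 1 = 1 :> G.
Proof. by rewrite /comm mulg1 mulgV invg1 mulg1. Qed.

Lemma comm_inv x y : (comm x y)^-1 = comm y x.
Proof. by rewrite /comm !(invgM, invgK) !mulgA. Qed.

Lemma comm_eq1 x y : comm x y = 1 <-> x * y = y * x.
Proof.
rewrite /comm; split=> [/divg1_eq/(canRL (mulgVK _))|->]; first by [].
by rewrite mulgK mulgV.
Qed.

Lemma comm_mull x y z : comm (x * y) z = x * comm y z * x^-1 * comm x z.
Proof. by rewrite /comm !(invgM, invgK) !mulgA !mulgVK. Qed.

Lemma comm_mulr x y z : comm x (y * z) = comm x y * (y * comm x z * y^-1).
Proof. by rewrite /comm !(invgM, invgK) !mulgA !mulgVK. Qed.

Lemma comm_conj x y z : z * comm x y * z^-1 = comm (z * x * z^-1) (z * y * z^-1).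
Proof. by rewrite /comm !(invgM, invgK) !mulgA !mulgVK. Qed.

Lemma gen_subgroup (X : set G) : is_subgroup (gen X).
Proof.
split=> [K [[]] //|x y Xx Xy K KX|x Xx K KX].
  by have [[_ KM _] _] := KX; apply: KM; [apply: Xx|apply: Xy].
by have [[_ _ KV] _] := KX; apply: KV; apply: Xx.
Qed.

Lemma gen_incl (X : set G) x : X x -> gen X x.
Proof. by move=> Xx K [_]; apply. Qed.

Lemma gen_min (X K : set G) : is_subgroup K -> (forall x, X x -> K x) ->
  forall x, gen X x -> K x.
Proof. by move=> sK XK x; apply. Qed.

Lemma commgs_subgroup H K : is_subgroup (commgs H K).
Proof. exact: gen_subgroup. Qed.

Lemma commgs_comm H K x y : H x -> K y -> commgs H K (comm x y).
Proof. by move=> Hx Ky; apply: gen_incl; exists x => //; exists y. Qed.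

Lemma commgs_min H K L : is_subgroup L ->
  (forall x y, H x -> K y -> L (comm x y)) -> forall z, commgs H K z -> L z.
Proof. by move=> sL HK; apply: gen_min => // _ [x Hx [y Ky <-]]; apply: HK. Qed.

Definition normalizes (K H : set G) :=
  forall k h, K k -> H h -> H (k * h * k^-1).

Lemma gen_conj (X : set G) (k : G) :
    (forall x, X x -> gen X (k * x * k^-1)) ->
  forall x, gen X x -> gen X (k * x * k^-1).
Proof.
move=> Xk; have [X1 XM XV] := gen_subgroup X.
apply: gen_min => //; split=> [|x y Xx Xy|x Xx].
- by rewrite mulg1 mulgV.
- by move: (XM _ _ Xx Xy); rewrite !mulgA mulgVK.
- by move: (XV _ Xx); rewrite !(invgM, invgK) mulgA.
Qed.

Lemma normalizes_commgs L H K :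
  normalizes L H -> normalizes L K -> normalizes L (commgs H K).
Proof.
move=> nH nK l h Ll; apply: gen_conj => _ [x Hx [y Ky <-]].
by rewrite comm_conj; apply: commgs_comm; [apply: nH|apply: nK].
Qed.

Lemma normal_closure_incl (K S : set G) x : S x -> normal_closure_in K S x.
Proof. by move=> Sx H [_]; apply. Qed.

Lemma normal_closure_min (K S H : set G) : is_normal_subgroup_of K H ->
  (forall x, S x -> H x) -> forall x, normal_closure_in K S x -> H x.
Proof. by move=> nH SH x; apply. Qed.

Lemma normal_closure_normal (K S : set G) :
    is_subgroup K -> (forall x, S x -> K x) ->
  is_normal_subgroup_of K (normal_closure_in K S).
Proof.
move=> [K1 KM KV] SK; split.
- split=> [H [[[]]] //|x y Sx Sy H HS|x Sx H HS].
    by have [[[_ HM _] _ _] _] := HS; apply: HM; [apply: Sx|apply: Sy].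
  by have [[[_ _ HV] _ _] _] := HS; apply: HV; apply: Sx.
- move=> x /(_ K); apply; split=> //; split=> // k h Kk Kh.
  by apply: (KM); [apply: KM|apply: KV].
- move=> k h Kk Sh H HS; have [[_ _ nH] _] := HS; apply: nH => //; exact: Sh.
Qed.

Lemma hom_group1 (D : groupType) (p : G -> D) :
  (forall x y, p (x * y) = p x * p y) -> p 1 = 1.
Proof. by move=> pM; apply: (mulgI (p 1)); rewrite -pM !mulg1. Qed.

Lemma hom_groupV (D : groupType) (p : G -> D) :
  (forall x y, p (x * y) = p x * p y) -> forall x, p x^-1 = (p x)^-1.
Proof.
by move=> pM x; apply: (mulgI (p x)); rewrite -pM !mulgV (hom_group1 pM).
Qed.

Lemma hom_comm (D : groupType) (p : G -> D) :
  (forall x y, p (x * y) = p x * p y) ->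
  forall x y, p (comm x y) = comm (p x) (p y).
Proof. by move=> pM x y; rewrite /comm !pM !(hom_groupV pM). Qed.

End GroupLemmas.

(** * Square-zero unipotents *)

Section Unipotent.
Variable S : pzRingType.
Implicit Types X Y : S.

Lemma unip_subproof1 X : X * X = 0 -> (1 + X) * (1 - X) = 1.
Proof. by move=> XX; transitivity (1 - X * X); [ncring|rewrite XX subr0]. Qed.

Lemma unip_subproof2 X : X * X = 0 -> (1 - X) * (1 + X) = 1.
Proof. by move=> XX; transitivity (1 - X * X); [ncring|rewrite XX subr0]. Qed.

(* 1 + X when X is square-zero; the junk value 1 otherwise. *)
Definition unip X : ring_units S :=
  if X * X =P 0 is ReflectT XX then
    mk_unit (unip_subproof1 XX) (unip_subproof2 XX)
  else one_unit S.

Lemma unipE X : X * X = 0 -> unit_val (unip X) = 1 + X.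
Proof. by rewrite /unip; case: eqP. Qed.

Lemma unit_valM (u v : ring_units S) : unit_val (u * v)%g = unit_val u * unit_val v.
Proof. by []. Qed.

Lemma unit_valVg (u : ring_units S) : unit_val u^-1%g = unit_inv u.
Proof. by []. Qed.

Lemma unip0 : unip 0 = 1%g.
Proof. by apply: unit_val_inj; rewrite unipE ?mulr0 // addr0. Qed.

Lemma unipM X Y : X * X = 0 -> Y * Y = 0 -> X * Y = 0 -> Y * X = 0 ->
  (unip X * unip Y)%g = unip (X + Y).
Proof.
move=> XX YY XY YX; apply: unit_val_inj; rewrite unit_valM !unipE //.
  have -> : (1 + X) * (1 + Y) = 1 + (X + Y) + X * Y by ncring.
  by rewrite XY addr0.
by rewrite mulrDl !mulrDr XX YY XY YX !addr0.
Qed.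

Lemma unipV X : X * X = 0 -> (unip X)^-1%g = unip (- X).
Proof.
move=> XX; apply: (mulgI (unip X)); rewrite mulgV unipM ?subrr ?unip0 //.
- by rewrite mulrNN.
- by rewrite mulrN XX oppr0.
- by rewrite mulNr XX oppr0.
Qed.

(** The common source of the Steinberg relations and of [unip_block]. *)
Lemma comm_unip X Y : X * X = 0 -> Y * Y = 0 -> Y * X = 0 ->
  comm (unip X) (unip Y) = unip (X * Y).
Proof.
move=> XX YY YX; rewrite /comm.
apply: (canLR (mulgK _)); apply: (canLR (mulgK _)); rewrite -mulgA.
have XYXY : X * Y * (X * Y) = 0 by rewrite mulrA -(mulrA X) YX mulr0 mul0r.
apply: unit_val_inj; rewrite !unit_valM !unipE //.
have -> : (1 + X * Y) * ((1 + Y) * (1 + X)) = (1 + X) * (1 + Y)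
   + (1 + X * Y) * (Y * X) + X * (Y * X) + X * (Y * Y) by ncring.
by rewrite YX YY !mulr0 !addr0.
Qed.

Lemma unip_conj (u : ring_units S) X : X * X = 0 ->
  (u * unip X * u^-1)%g = unip (unit_val u * X * unit_inv u).
Proof.
move=> XX; apply: unit_val_inj; rewrite !unit_valM unit_valVg !unipE //.
  by rewrite mulrDr mulr1 mulrDl unit_valV.
rewrite !mulrA -(mulrA _ (unit_inv u)) unit_Vval mulr1.
by rewrite -(mulrA (unit_val u)) XX mulr0 mul0r.
Qed.

Lemma unip_sum (I : Type) (r : seq I) (P : pred I) (F : I -> S) :
    (forall i j, P i -> P j -> F i * F j = 0) ->
  unip (\sum_(i <- r | P i) F i) = (\prod_(i <- r | P i) unip (F i))%g.
Proof.
move=> FF; elim: r => [|i r IH]; first by rewrite !big_nil unip0.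
rewrite !big_cons; case: ifP => // Pi; rewrite -IH.
have F0 k : P k -> F k * \sum_(j <- r | P j) F j = 0.
  by move=> Pk; rewrite mulr_sumr big1 // => j; apply: FF.
rewrite unipM //; first exact: FF; last first.
- by rewrite mulr_suml big1 // => j Pj; apply: FF.
- exact: F0.
- by rewrite mulr_suml big1.
Qed.

(** The factors commute because the products of the [F i] vanish, so any one of them can be moved to
    either end. *)
Lemma prod_unipD1 (I : finType) (P : pred I) (F : I -> S) m : P m ->
    (forall i j, P i -> P j -> F i * F j = 0) ->
  (\prod_(i | P i) unip (F i)
   = unip (F m) * \prod_(i | P i && (i != m)) unip (F i))%g /\
  (\prod_(i | P i) unip (F i)
   = \prod_(i | P i && (i != m)) unip (F i) * unip (F m))%g.
Proof.
move=> Pm FF; have Fm i : P i && (i != m) -> P i by case/andP.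
have mF : F m * \sum_(i | P i && (i != m)) F i = 0.
  by rewrite mulr_sumr big1 // => i /Fm Pi; apply: FF.
have Fm' : (\sum_(i | P i && (i != m)) F i) * F m = 0.
  by rewrite mulr_suml big1 // => i /Fm Pi; apply: FF.
have FF' : (\sum_(i | P i && (i != m)) F i) * \sum_(i | P i && (i != m)) F i = 0.
  rewrite mulr_suml big1 // => i /Fm Pi; rewrite mulr_sumr big1 // => j /Fm Pj.
  exact: FF.
rewrite -unip_sum // -unip_sum => [|i j /Fm Pi /Fm Pj]; last exact: FF.
by rewrite !unipM ?FF // (bigD1 m) //= addrC.
Qed.

End Unipotent.

(** * Elementary matrices and rank-one unipotents *)

Section Elementary.
Variables (n : nat) (A : pzRingType).
Implicit Types (i j k l q : 'I_n) (a b c d : A) (v : 'I_n -> A).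
Local Notation M := ('M[A]_n).

Definition E i j a : M := a *: delta_mx i j.

Lemma E0 i j : E i j 0 = 0. Proof. exact: scale0r. Qed.
Lemma ED i j a b : E i j (a + b) = E i j a + E i j b.
Proof. exact: scalerDl. Qed.
Lemma EN i j a : E i j (- a) = - E i j a. Proof. exact: scaleNr. Qed.
Lemma EB i j a b : E i j (a - b) = E i j a - E i j b.
Proof. by rewrite ED EN. Qed.
Lemma Esum (I : Type) (r : seq I) (P : pred I) i j (F : I -> A) :
  E i j (\sum_(k <- r | P k) F k) = \sum_(k <- r | P k) E i j (F k).
Proof. exact: (big_morph (E i j) (@ED i j) (@E0 i j)). Qed.

Lemma E_mulr (V : M) i j a : E i j a * V = \sum_l E i l (a * V j l).
Proof.
apply/matrixP => p q; rewrite summxE mxE (bigD1 j) //= big1 => [|m mj].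
  rewrite (bigD1 q) //= big1 => [|m mq]; last first.
    by rewrite !mxE (eq_sym q) (negPf mq) andbF mulr0.
  rewrite !mxE !eqxx !andbT !addr0; case: (p == i).
    by rewrite !mulr1.
  by rewrite !mulr0 mul0r.
by rewrite !mxE (negPf mj) andbF mulr0 mul0r.
Qed.

Lemma E_mull (U : M) i j a : U * E i j a = \sum_l E l j (U l i * a).
Proof.
apply/matrixP => p q; rewrite summxE mxE (bigD1 i) //= big1 => [|m mj].
  rewrite (bigD1 p) //= big1 => [|m mq]; last first.
    by rewrite !mxE (eq_sym p) (negPf mq) mulr0.
  rewrite !mxE !eqxx !addr0 /=; case: (q == j).
    by rewrite !mulr1.
  by rewrite !mulr0.
by rewrite !mxE (negPf mj) !mulr0.
Qed.

Lemma EE i j k l a b : E i j a * E k l b = if j == k then E i l (a * b) else 0.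
Proof.
rewrite E_mulr; case: eqVneq => [->|njk].
  rewrite (bigD1 l) //= big1 => [|m ml]; first by rewrite !mxE !eqxx mulr1 addr0.
  by rewrite !mxE (negPf ml) andbF !mulr0 E0.
by rewrite big1 // => m _; rewrite !mxE (negPf njk) !mulr0 E0.
Qed.

Lemma EEid i j l a b : E i j a * E j l b = E i l (a * b).
Proof. by rewrite EE eqxx. Qed.

Lemma EE0 i j k l a b : j != k -> E i j a * E k l b = 0.
Proof. by rewrite EE => /negPf->. Qed.

Lemma Esq i j a : i != j -> E i j a * E i j a = 0.
Proof. by move=> ij; rewrite EE0 // eq_sym. Qed.

(** Unlike [elem], this carries no proof of [i != j], which makes products over indices easy to
    write. *)
Definition el i j a : GL n A := unip (E i j a).

Lemma elE i j (ij : i != j) a : elem ij a = el i j a.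
Proof. by apply: unit_val_inj; rewrite unipE ?Esq. Qed.

Lemma el0 i j : el i j 0 = 1%g.
Proof. by rewrite /el E0 unip0. Qed.

Lemma elD i j a b : i != j -> el i j (a + b) = (el i j a * el i j b)%g.
Proof. by move=> ij; rewrite /el ED unipM // EE0 // eq_sym. Qed.

Lemma elN i j a : i != j -> el i j (- a) = (el i j a)^-1%g.
Proof. by move=> ij; rewrite /el EN unipV // Esq. Qed.

Lemma el_comm i j k l a b : i != j -> k != l -> j != k -> i != l ->
  comm (el i j a) (el k l b) = 1%g.
Proof.
move=> ij kl jk il; rewrite comm_unip ?EE0 ?unip0 //; rewrite eq_sym //.
Qed.

Lemma el_commM i j k l a b : i != j -> k != l -> j != k -> i != l ->
  (el i j a * el k l b = el k l b * el i j a)%g.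
Proof. by move=> *; apply/comm_eq1/el_comm. Qed.

Lemma el_st i j k a b : i != j -> j != k -> i != k ->
  comm (el i j a) (el j k b) = el i k (a * b).
Proof.
by move=> ij jk ik; rewrite comm_unip ?EEid // EE0 // eq_sym.
Qed.

Lemma third_index i j : (3 <= n)%N -> exists k, (k != i) && (k != j).
Proof.
move=> n3; case: (pickP (fun k => (k != i) && (k != j))) => [k|ij].
  by exists k.
have : (#|'I_n| <= #|[set i; j]|)%N.
  apply: subset_leq_card; apply/fintype.subsetP => k _.
  by have := ij k; rewrite finset.in_set2 -negb_or => /negPn.
by rewrite card_ord cards2 leqNgt (leq_trans _ n3) //; case: (i != j).
Qed.

(* The rank-one matrix [(d e_i + c e_j) a (d' e_j^T - c' e_i^T)], orthogonality
   of row and column being [d' c = c' d], is written as a commutator through a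
   third index. *)
Lemma unip_block i j k a d c d' c' : k != i -> k != j -> i != j ->
    d' * c = c' * d ->
  unip (E i j (d * a * d') - E i i (d * a * c') + E j j (c * a * d')
        - E j i (c * a * c'))
  = comm (el i k d * el j k c)%g (el k j (a * d') * el k i (- (a * c')))%g.
Proof.
move=> ki kj ij dc; have ik : i != k by rewrite eq_sym.
have jk : j != k by rewrite eq_sym.
have ji : j != i by rewrite eq_sym.
have EEn := (EE, eqxx, negPf ki, negPf kj, negPf ij, negPf ik, negPf jk, negPf ji).
rewrite !unipM; rewrite ?EEn //.
rewrite comm_unip; rewrite ?(mulrDl, mulrDr) !EEn ?addr0 //.
  by rewrite !mulrN !EN !mulrA -!addrA.
by rewrite add0r -ED mulNr -!mulrA dc subrr E0.
Qed.

Definition rowm j v : M := \sum_l E j l (v l).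

Lemma E_rowm i j a v : E i j a * rowm j v = rowm i (fun l => a * v l).
Proof. by rewrite mulr_sumr; apply: eq_bigr => l _; rewrite EEid. Qed.

Lemma E_mul_rowm i j a (V : M) : E i j a * V = E i j a * rowm j (V j).
Proof. by rewrite E_mulr E_rowm. Qed.

Lemma rowm_E j k l v b : rowm j v * E k l b = E j l (v k * b).
Proof.
rewrite mulr_suml (bigD1 k) //= EEid big1 ?addr0 // => m mk.
by rewrite EE0.
Qed.

Section CentralPivot.
Variable s : A.
Hypothesis sC : forall a, s * a = a * s.

(** A column supported in rows [q] and [j], chosen to be annihilated by every row [v] whose entry at
    [j] is [s]. *)
Definition pcol q j v b : M := E q j (s * b) - E j j (v q * b).

Lemma rowm_pcol q j v b : v j = s -> rowm j v * pcol q j v b = 0.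
Proof.
move=> vj; rewrite mulrBr !rowm_E vj -EB mulrA -sC !mulrA subrr E0 //.
Qed.

(** The row is split: its entries at [j] and [q] give a matrix of the form treated in [unip_block],
    and each other entry gives a commuting pair of elementary matrices. *)
Lemma unip_pcol q j k v b : k != q -> k != j -> q != j -> v j = s ->
  unip (pcol q j v b * rowm j v) =
  (comm (el q k s * el j k (- v q)) (el k j (b * s) * el k q (b * v q)) *
   \prod_(l | (l != j) && (l != q))
      (el q l (s * b * v l) * el j l (- (v q * b * v l))))%g.
Proof.
move=> kq kj qj vj; have jq : j != q by rewrite eq_sym.
have qk : q != k by rewrite eq_sym.
have jk : j != k by rewrite eq_sym.
set C := pcol q j v b; pose G l := E j l (v l).
have GC l : l != j -> l != q -> G l * C = 0.
  by move=> lj lq; rewrite mulrBr !EE0 ?subr0.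
have HC : (G j + G q) * C = 0.
  by rewrite /G /C mulrDl !mulrBr !EE !eqxx (negPf jq) (negPf qj) subr0 sub0r
    addrC vj -EB mulrA -sC !mulrA subrr E0.
have CC X Y : X * C = 0 -> C * X * (C * Y) = 0.
  by move=> XC; rewrite mulrA -(mulrA C) XC mulr0 mul0r.
have -> : C * rowm j v = C * (G j + G q)
                       + \sum_(l | (l != j) && (l != q)) C * G l.
  rewrite /rowm (bigD1 j) //= (bigD1 q) //= addrA mulrDr; congr (_ + _).
  by rewrite mulr_sumr.
have C0l : (\sum_(l | (l != j) && (l != q)) C * G l) * C = 0.
  rewrite mulr_suml big1 // => l /andP[lj lq].
  by rewrite -mulrA GC ?mulr0.
rewrite -unipM; first 1 last.
- exact: CC.
- by rewrite -mulr_sumr in C0l *; rewrite mulrA C0l mul0r.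
- by rewrite -mulr_sumr; apply: CC.
- by rewrite mulrA C0l mul0r.
congr (_ * _)%g.
  have -> : C * (G j + G q) = E q j (s * b * s) - E q q (s * b * - v q)
              + E j j (- v q * b * s) - E j q (- v q * b * - v q).
    rewrite /C /G vj mulrBl !mulrDr !EEid !mulrN !mulNr !EN !opprK opprD.
    by rewrite !addrA.
  rewrite (unip_block b kq kj qj (d := s) (d' := s)) ?sC //.
  by rewrite mulrN opprK.
rewrite unip_sum => [|l l' /andP[lj lq] _]; last first.
  by rewrite mulrA -(mulrA C) GC // mulr0 mul0r.
apply: eq_bigr => l /andP[lj lq].
have -> : C * G l = E q l (s * b * v l) + E j l (- (v q * b * v l)).
  by rewrite mulrBl !EEid EN.
by rewrite unipM // EE0 // ?(eq_sym l).
Qed.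

(* Decomposition of unipotents, in a form that needs only one entry of a row of
   [g^-1] to be invertible up to the central [s]: the columns on the right have
   two nonzero entries. *)
Lemma conj_E_decomposition (g : GL n A) i j a x : i != j ->
    unit_inv g j j * x = s -> x * unit_inv g j j = s ->
    let v := fun l => x * unit_inv g j l in
  unit_val g * E i j (s * s * a) * unit_inv g = \sum_(q | q != j)
    pcol q j v (unit_val g q i * a * unit_inv g j j) * rowm j v.
Proof.
set U := unit_val g; set V := unit_inv g; set y := V j j => ij yx xy v.
have vj : v j = s by [].
have rowE : rowm j v = E j j x * rowm j (V j) by rewrite E_rowm.
(* Since [v j = s], this expresses s U_ji through the other entries of column [i] of [g], and so
   produces the entries of the [pcol] in row [j]. *)
have vU : \sum_q v q * U q i = 0.
  rewrite /v; transitivity (x * (V * U) j i); last first.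
    by rewrite unit_Vval !mxE eq_sym (negPf ij) mulr0.
  by rewrite mxE mulr_sumr; apply: eq_bigr => q _; rewrite mulrA.
transitivity (\sum_q E q j (s * U q i * a * s) * rowm j (V j)).
  rewrite E_mull mulr_suml; apply: eq_bigr => q _.
  rewrite [LHS]E_mul_rowm; congr (E _ _ _ * _).
  by rewrite -/U -[RHS]sC !mulrA -sC -sC !mulrA.
rewrite -!mulr_suml rowE.
rewrite mulrA; congr (_ * _); rewrite mulr_suml.
under [RHS]eq_bigr do rewrite mulrBl !EEid -!mulrA yx.
rewrite (bigD1 j) //= sumrB addrC -Esum; congr (_ + _).
  by apply: eq_bigr => q _; rewrite !mulrA.
rewrite -EN; congr (E _ _ _); move: vU; rewrite (bigD1 j) //= vj => /eqP.
rewrite addr_eq0 => /eqP->; rewrite !mulNr !mulr_suml; congr (- _).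
by apply: eq_bigr => q _; rewrite !mulrA.
Qed.

Lemma pcol_pcol q q' j v b b' : v j = s ->
  pcol q j v b * rowm j v * (pcol q' j v b' * rowm j v) = 0.
Proof. by move=> vj; rewrite mulrA -(mulrA _ (rowm j v)) rowm_pcol // mulr0 mul0r. Qed.

Lemma conj_el_decomposition (g : GL n A) i j a x : i != j ->
    unit_inv g j j * x = s -> x * unit_inv g j j = s ->
    let v := fun l => x * unit_inv g j l in
  (g * el i j (s * s * a) * g^-1 = \prod_(q | q != j)
     unip (pcol q j v (unit_val g q i * a * unit_inv g j j) * rowm j v))%g.
Proof.
move=> ij yx xy v; rewrite -unip_sum => [|q q' _ _]; last exact: pcol_pcol.
by rewrite unip_conj ?Esq // (conj_E_decomposition _ ij yx xy).
Qed.

End CentralPivot.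

(** The counterpart of [unip_pcol] with rows and columns exchanged: here the column is long and the
    row has two entries, orthogonal to it by hypothesis. *)
Lemma unip_colblock (V : M) i j k a d' c' : k != i -> k != j -> i != j ->
    d' * V j i = c' * V i i ->
  unip (V * (E i j (a * d') - E i i (a * c'))) =
  (comm (el i k (V i i) * el j k (V j i)) (el k j (a * d') * el k i (- (a * c')))
   * \prod_(l | (l != i) && (l != j))
       (el l j (V l i * a * d') * el l i (- (V l i * a * c'))))%g.
Proof.
move=> ki kj ij dc; have ji : j != i by rewrite eq_sym.
set W := E i j _ - _; pose F l := E l i (V l i).
have FW l : F l * W = E l j (V l i * a * d') - E l i (V l i * a * c').
  by rewrite mulrBr !EEid !mulrA.
have WF l : l != i -> l != j -> W * F l = 0.
  by move=> li lj; rewrite mulrBl !EE0 1?eq_sym // subr0.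
have WFF : W * (F i + F j) = 0.
  rewrite mulrDr !mulrBl !EE !eqxx (negPf ji) (negPf ij) subr0 sub0r addrC -EB.
  by rewrite -!mulrA dc subrr E0.
have WW X Y : W * Y = 0 -> X * W * (Y * W) = 0.
  by move=> WY; rewrite mulrA -(mulrA X) WY mulr0 mul0r.
have WS : W * \sum_(l | (l != i) && (l != j)) F l = 0.
  by rewrite mulr_sumr big1 // => l /andP[li lj]; apply: WF.
have -> : V * W = (F i + F j) * W + (\sum_(l | (l != i) && (l != j)) F l) * W.
  rewrite -mulrDl -addrA.
  have <- : \sum_l F l = F i + (F j + \sum_(l | (l != i) && (l != j)) F l).
    by rewrite (bigD1 i) //= (bigD1 j).
  rewrite mulrBr !E_mull -sumrB mulr_suml; apply: eq_bigr => l _.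
  by rewrite FW !mulrA.
rewrite -unipM; [|exact: WW|exact: WW|exact: WW|exact: WW].
congr (_ * _)%g.
  by rewrite mulrDl !FW addrA (unip_block a ki kj ij dc).
rewrite mulr_suml unip_sum => [|l l' _ /andP[l'i l'j]]; last exact/WW/WF.
apply: eq_bigr => l /andP[li lj]; rewrite FW -EN unipM // EE0 // 1?eq_sym //.
Qed.

End Elementary.

(** * Congruence subgroups and relative elementary groups *)

Section CongruenceSubgroups.
Variables (n : nat) (A : pzRingType).
Implicit Types (g h : GL n A) (i j k : 'I_n) (I J : two_sided_ideal A).

Lemma units_mapM (S T : pzRingType) (f : {rmorphism S -> T}) (u v : ring_units S) :
  units_map f (u * v)%g = (units_map f u * units_map f v)%g.
Proof. by apply: unit_val_inj; apply: rmorphM. Qed.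

Lemma units_map1 (S T : pzRingType) (f : {rmorphism S -> T}) :
  units_map f (1%g : ring_units S) = 1%g.
Proof. by apply: unit_val_inj; apply: rmorph1. Qed.

Lemma units_mapV (S T : pzRingType) (f : {rmorphism S -> T}) (u : ring_units S) :
  units_map f u^-1%g = (units_map f u)^-1%g.
Proof. by apply: (mulgI (units_map f u)); rewrite -units_mapM !mulgV units_map1. Qed.

Notation cong I := (principal_congruence_subgroup n I).

Lemma cong_subgroup I : is_subgroup (cong I).
Proof.
rewrite /principal_congruence_subgroup; split=> [|x y /= Ix Iy|x /= Ix].
- exact: units_map1.
- by rewrite units_mapM Ix Iy mulg1.
- by rewrite units_mapV Ix invg1.
Qed.

Lemma cong_normal I (L : set (GL n A)) : normalizes L (cong I).
Proof.
rewrite /principal_congruence_subgroup => k h /= _ Ih.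
by rewrite !units_mapM units_mapV Ih mulg1 mulgV.
Qed.

Lemma congP I g :
  cong I g <-> forall i j, I (unit_val g i j - (i == j)%:R).
Proof.
have q1 i j : quotient_map I (i == j)%:R = (i == j)%:R.
  by case: (i == j); rewrite ?rmorph1 ?rmorph0.
rewrite /principal_congruence_subgroup /=; split=> [g1 i j|Ig].
  have := congr1 (fun u : GL n _ => (unit_val u : 'M_n) i j) g1.
  by rewrite /= !mxE -q1 => /eqP/quotient_eqP.
apply: unit_val_inj; apply/matrixP => i j; rewrite !mxE -q1.
exact/eqP/quotient_eqP.
Qed.

Lemma congVP I g : cong I g -> forall i j, I (unit_inv g i j - (i == j)%:R).
Proof. by have [_ _ cV] := cong_subgroup I; move=> /cV /congP. Qed.

Notation Eg := (elementary_group n A).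
Notation rel I := (relative_elementary_group n I).

Lemma Eg_subgroup : is_subgroup Eg. Proof. exact: gen_subgroup. Qed.

Lemma el_Eg i j a : i != j -> Eg (el i j a).
Proof. by move=> ij; apply: gen_incl; exists i, j, ij, a; rewrite elE. Qed.

Lemma rel_subgroup I : is_subgroup (rel I).
Proof.
have [|//] := @normal_closure_normal _ Eg (elementary_group_ideal n I) Eg_subgroup.
move=> x; apply: gen_min; first exact: Eg_subgroup.
by move=> _ [i [j [ij [a [_ ->]]]]]; rewrite elE; apply: el_Eg.
Qed.

Lemma rel_normal I : normalizes Eg (rel I).
Proof.
have [|//] := @normal_closure_normal _ Eg (elementary_group_ideal n I) Eg_subgroup.
move=> x; apply: gen_min; first exact: Eg_subgroup.
by move=> _ [i [j [ij [a [_ ->]]]]]; rewrite elE; apply: el_Eg.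
Qed.

Lemma el_rel I i j a : i != j -> I a -> rel I (el i j a).
Proof.
move=> ij Ia; apply: normal_closure_incl; apply: gen_incl.
by exists i, j, ij, a; rewrite elE.
Qed.

Lemma rel_min I (H : set (GL n A)) : is_subgroup H -> normalizes Eg H ->
    (forall i j a, i != j -> I a -> H (el i j a)) ->
  forall x, rel I x -> H x.
Proof.
move=> sH nH elH x relx.
(* The normal closure is taken among subgroups of [Eg], so [H] has to be intersected with it. *)
suff [] : H x /\ Eg x by [].
have [H1 HM HV] := sH; have [E1 EM EV] := Eg_subgroup.
move: x relx; apply: normal_closure_min.
  split; first split=> //.
  - by move=> y z [Hy Ey] [Hz Ez]; split; [apply: HM|apply: EM].
  - by move=> y [Hy Ey]; split; [apply: HV|apply: EV].
  - by move=> y [].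
  - move=> k h Ek [Hh Eh]; split; first exact: nH.
    by apply: (EM); [apply: EM|apply: EV].
apply: gen_min => [|_ [i [j [ij [a [Ia ->]]]]]].
  split=> //.
  - by move=> y z [Hy Ey] [Hz Ez]; split; [apply: HM|apply: EM].
  - by move=> y [Hy Ey]; split; [apply: HV|apply: EV].
by rewrite elE; split; [apply: elH|apply: el_Eg].
Qed.

Lemma el_cong I i j a : i != j -> I a -> cong I (el i j a).
Proof.
move=> ij Ia; apply/congP => k l; rewrite unipE ?Esq // !mxE addrAC subrr add0r.
by apply: Defs.idealMr.
Qed.

Lemma rel_cong I x : rel I x -> cong I x.
Proof.
apply: rel_min; [exact: cong_subgroup|exact: cong_normal|].
by move=> i j a ij Ia; apply: el_cong.
Qed.

Lemma prod_in (H : set (GL n A)) (T : Type) (r : seq T) (P : pred T) F :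
  is_subgroup H -> (forall t, P t -> H (F t)) -> H (\prod_(t <- r | P t) F t)%g.
Proof. by move=> [H1 HM _] HF; elim/big_ind: _. Qed.

(* Right multiplication of g^-1 by an elementary matrix of level J changes the
   pivot (g^-1)_jj by an arbitrary multiple of 1 - (g^-1)_jj g_jj. *)
Lemma pivot_factor g j c :
  let eps := (\prod_(q | q != j) el q j (unit_val g q j * c))%g in
  unit_inv (eps^-1 * g)%g j j
  = unit_inv g j j + (1 - unit_inv g j j * unit_val g j j) * c.
Proof.
move=> eps; have -> : eps = unip (\sum_(q | q != j) E q j (unit_val g q j * c)).
  by rewrite unip_sum // => q q' _ q'j; rewrite EE0 // eq_sym.
set X := \sum_(q | _) _; have XX : X * X = 0.
  rewrite mulr_suml big1 // => q qj; rewrite mulr_sumr big1 // => q' q'j.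
  by rewrite EE0 // eq_sym.
have -> : unit_inv ((unip X)^-1 * g)%g = unit_inv g * (1 + X).
  by rewrite -unipE.
rewrite mulrDr mulr1 mxE; congr (_ + _).
rewrite mulr_sumr summxE.
transitivity (\sum_(q | q != j) unit_inv g j q * unit_val g q j * c).
  apply: eq_bigr => q qj; rewrite E_mull summxE (bigD1 j) //= big1 => [|l lj].
    by rewrite !mxE !eqxx mulr1 addr0 mulrA.
  by rewrite !mxE (eq_sym j) (negPf lj) mulr0.
rewrite -mulr_suml; congr (_ * _); apply/eqP; rewrite eq_sym subr_eq.
have := congr1 (fun M : 'M_n => M j j) (unit_Vval g).
by rewrite !mxE eqxx (bigD1 j) //= addrC => ->.
Qed.

End CongruenceSubgroups.

(** * The double commutator formula *)

Section Double.
Variables (n : nat) (A : pzRingType) (I J : two_sided_ideal A).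
Hypothesis n3 : (3 <= n)%N.
Implicit Types (g h : GL n A) (i j k l q : 'I_n).
Notation cong I := (principal_congruence_subgroup n I).
Notation Eg := (elementary_group n A).

Variable H : set (GL n A).
Hypotheses (sH : is_subgroup H) (nH : normalizes Eg H).
Hypothesis HIJ : forall i j a b, i != j -> I a -> J b -> H (el i j (a * b)).
Hypothesis HJI : forall i j a b, i != j -> I a -> J b -> H (el i j (b * a)).
Hypothesis Hy : forall i j a b, i != j -> I a -> J b ->
  H (comm (el i j a) (el j i b)).

Let H1 : H 1%g. Proof. by case: sH. Qed.
Let HM x y : H x -> H y -> H (x * y)%g. Proof. by case: sH => _ + _; apply. Qed.
Let HV x : H x -> H x^-1%g. Proof. by case: sH => _ _; apply. Qed.
Let EM x y : Eg x -> Eg y -> Eg (x * y)%g.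
Proof. by case: (Eg_subgroup n A) => _ + _; apply. Qed.
Let EV x : Eg x -> Eg x^-1%g.
Proof. by case: (Eg_subgroup n A) => _ _; apply. Qed.
Let nHV x h : Eg x -> H h -> H (x^-1 * h * x)%g.
Proof. by move=> /EV Ex Hh; have := nH Ex Hh; rewrite invgK. Qed.

Lemma comm_in_l x y : H x -> Eg y -> H (comm x y).
Proof.
move=> Hx Ey; rewrite /comm -!mulgA; apply: HM => //.
by rewrite mulgA; apply/nH/HV.
Qed.

Lemma comm_in_r x y : H y -> Eg x -> H (comm x y).
Proof. by move=> Hy' Ex; rewrite -comm_inv; apply/HV/comm_in_l. Qed.

(** In [unip_pcol] every factor involving an entry of [v] away from [j] contributes an elementary
    matrix with entry in IJ or an elementary commutator, both in [H]. Only [e_qk(s), e_kj(b s)] =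
    e_qj(s b s) survives. *)
Lemma unip_pcol_in (s : A) q j (v : 'I_n -> A) b :
    (forall a, s * a = a * s) -> q != j -> v j = s ->
    (forall l, l != j -> J (v l)) -> I b ->
  H ((el q j (s * b * s))^-1 * unip (pcol s q j v b * rowm j v))%g.
Proof.
move=> sC qj vj Jv Ib; have [k /andP[kq kj]] := third_index q j n3.
have qk : q != k by rewrite eq_sym.
have jk : j != k by rewrite eq_sym.
have Jq := Jv _ qj.
rewrite (unip_pcol sC b kq kj qj vj) mulgA; apply: HM; last first.
  apply: prod_in => // l /andP[lj lq]; apply: HM.
    by apply: HIJ; rewrite 1?eq_sym //; [apply: idealMl|apply: Jv].
  rewrite -mulNr; apply: HIJ; rewrite 1?eq_sym //; last exact: Jv.
  by rewrite -mulNr; apply: idealMl.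
rewrite comm_mulr comm_mull.
have <- : comm (el q k s) (el k j (b * s)) = el q j (s * b * s).
  by rewrite el_st // mulrA.
set e := comm (el q k s) _; rewrite mulgA; apply: HM.
  have Ee : Eg e by rewrite /e el_st //; apply: el_Eg.
  rewrite [X in H X]mulgA; apply: nHV => //.
  apply: nH; first exact: el_Eg.
  rewrite -comm_inv; apply: HV; apply: Hy => //; last exact: idealN.
  exact: Defs.idealMr.
apply: nH; first exact: el_Eg.
apply: comm_in_r; last by apply: EM; apply: el_Eg.
by apply: HIJ.
Qed.

Lemma prod_coset (P : pred 'I_n) (F : 'I_n -> GL n A) i e :
    P i -> Eg e -> H (e^-1 * F i)%g -> (forall q, P q -> q != i -> H (F q)) ->
  H (e^-1 * \prod_(q | P q) F q)%g.
Proof.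
move=> Pi Ee Fi HF; move: (index_enum_uniq 'I_n) (mem_index_enum i).
move: (index_enum _) => r ur ir; case/splitPr: ir ur => r1 r2.
rewrite cat_uniq /= negb_or => /and3P[_ /andP[ir1 _] /andP[ir2 _]].
have Hr t : i \notin t -> H (\prod_(q <- t | P q) F q)%g.
  move=> it; rewrite big_seq_cond; apply: prod_in => // q /andP[qr Pq].
  by apply: HF => //; apply: contraNneq it => <-.
rewrite big_cat big_cons Pi /= !mulgA; apply: HM (Hr _ ir2).
rewrite -[F i](mulVKg e) mulgA; apply: HM => //.
by apply: nHV => //; apply: Hr.
Qed.

(** In the decomposition of the conjugate, the factor at [q] is e_qj(s U_qi a V_jj s) modulo [H],
    with U = g and V = g^-1. For q != i this lies in [H] because U_qi is in [J]; for q = i it agrees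
    with e_ij(s^2 a) because U_ii and V_jj are in 1 + J. *)
Lemma comm_el_pivot (s x a : A) i j g :
    (forall a, s * a = a * s) -> i != j -> I a -> cong J g ->
    unit_inv g j j * x = s -> x * unit_inv g j j = s ->
  H (comm (el i j (s * s * a)) g).
Proof.
move=> sC ij Ia Jg yx xy; set e := el i j _.
have Ee : Eg e by apply: el_Eg.
suff Hc : H (e^-1 * (g * e * g^-1))%g.
  have -> : comm e g = (e * (e^-1 * (g * e * g^-1))^-1 * e^-1)%g.
    by rewrite /comm !(invgM, invgK) !mulgA mulgK.
  exact/nH/HV.
rewrite /e (conj_el_decomposition sC a ij yx xy).
set v := fun l => _.
have /congP Jg' := Jg; have Jg'' := congVP Jg.
have Jv l : l != j -> J (v l).
  move=> lj; apply: idealMl; have := Jg'' j l.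
  by rewrite eq_sym (negPf lj) subr0.
have Ib q : I (unit_val g q i * a * unit_inv g j j).
  by apply: Defs.idealMr; apply: idealMl.
have Xq q qj := unip_pcol_in (q := q) sC qj xy Jv (Ib q).
apply: (prod_coset (i := i)) => //.
  rewrite -[unip _](mulVKg (el i j (s * (unit_val g i i * a * unit_inv g j j) * s))).
  rewrite mulgA; apply: HM (Xq i ij).
  rewrite -elN // -elD //.
  have split_b (u y : A) : - (s * s * a) + s * (u * a * y) * s
      = s * s * (u - 1) * (a * y) + s * s * a * (y - 1).
    by rewrite -[s * (u * a * y) * s]sC; ncring.
  rewrite split_b elD //; apply: HM.
    apply: HJI => //; first exact: Defs.idealMr.
    by apply: idealMl; have := Jg' i i; rewrite eqxx.
  apply: HIJ => //; first exact: idealMl.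
  by have := Jg'' j j; rewrite eqxx.
move=> q qj qi.
rewrite -[unip _](mulVKg (el q j (s * (unit_val g q i * a * unit_inv g j j) * s))).
apply: HM (Xq q qj); rewrite !mulrA -[X in el q j X]mulrA -[X in el q j X]mulrA.
apply: HJI => //; first exact: Defs.idealMr.
by apply: idealMl; have := Jg' q i; rewrite (negPf qi) subr0.
Qed.

(** [H] is left arbitrary so that this serves twice: with [J] the unit ideal it makes E(n, A, I)
    normal in GL(n, A), and with [H] equal to [comm_gens] it bounds [E(n, A, I), GL(n, A, J)]. *)
Lemma comm_el_cong i j a g : quasi_finite_ring A -> i != j -> I a -> cong J g ->
  H (comm (el i j a) g).
Proof.
move=> [R [phi [phiC qfA]]] ij Ia Jg.
pose Q r := forall a, I a -> H (comm (el i j (phi r * a)) g).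
suff: Q 1 by move=> /(_ a Ia); rewrite rmorph1 mul1r.
apply: (local_global phiC qfA (a := unit_inv g j j) (w := unit_val g j j)).
- by move=> b _; rewrite rmorph0 mul0r el0 comm_1l.
- move=> r r' Qr Qr' b Ib; rewrite rmorphD mulrDl elD // comm_mull.
  by apply: HM; [apply: nH; [apply: el_Eg|apply: Qr']|apply: Qr].
- by move=> r r' Qr' b Ib; rewrite mulrC rmorphM -mulrA; apply/Qr'/idealMl.
(* The exponent is that of [s] in [comm_el_pivot]. *)
move=> c r x y yx xy; exists 2%N => b Ib.
pose eps := (\prod_(q | q != j) el q j (unit_val g q j * c))%g.
have Jc q : q != j -> J (unit_val g q j * c).
  move=> qj; apply: Defs.idealMr; have /congP/(_ q j) := Jg.
  by rewrite (negPf qj) subr0.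
have [J1 JM JV] := cong_subgroup n J.
have Jeps : cong J eps.
  by apply: prod_in => // q qj; apply: el_cong => //; apply: Jc.
have Eeps : Eg eps by apply: prod_in => [|q qj]; [apply: Eg_subgroup|apply: el_Eg].
(* All factors of [eps] and the given elementary matrix live in column [j], so they commute; only
   [eps^-1 * g], with its improved pivot, remains. *)
rewrite -[g](mulVKg eps) comm_mulr; apply: HM.
  rewrite (_ : comm _ _ = 1%g) //; apply/comm_eq1.
  rewrite /eps; elim/big_ind: _ => [|u v ue ve|q qj]; first by rewrite mulg1 mul1g.
    by rewrite mulgA ue -mulgA ve mulgA.
  by apply: el_commM => //; rewrite eq_sym.
apply: nH => //; rewrite rmorphXn expr2.
apply: (comm_el_pivot (x := x)) => //; first by apply: JM => //; apply: JV.
  by rewrite pivot_factor.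
by rewrite pivot_factor.
Qed.
End Double.

(** * Commutation modulo a normal subgroup *)

Section QuotientGroup.
Variables (G : groupType) (N : set G).
Hypotheses (sN : is_subgroup N) (nN : normalizes setT N).
Local Open Scope group_scope.

Let N1 : N 1. Proof. by case: sN. Qed.
Let NM x y : N x -> N y -> N (x * y). Proof. by case: sN => _ + _; apply. Qed.
Let NV x : N x -> N x^-1. Proof. by case: sN => _ _; apply. Qed.

Let eqN (x y : G) : bool := `[< N (x * y^-1) >].

Let eqN_equiv : equiv_class_of eqN.
Proof.
split=> [x|x y|y x z].
- by apply/asboolP; rewrite mulgV.
- by apply/asboolP/asboolP => /NV; rewrite invgM invgK.
- move=> /asboolP xy /asboolP yz; apply/asboolP.
  by have := NM xy yz; rewrite mulgA mulgVK.
Qed.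

Let eqN_rel := EquivRelPack eqN_equiv.
Let Q := {eq_quot eqN_rel}%qT.

Let pi (x : G) : Q := (\pi_Q x)%qT.

Let piP (x y : G) : reflect (N (x * y^-1)) (pi x == pi y).
Proof. by rewrite eqquotE; apply: asboolP. Qed.

Let piK (u : Q) : pi (repr u) = u. Proof. exact: reprK. Qed.

Let qm (u v : Q) : Q := pi (repr u * repr v).
Let qv (u : Q) : Q := pi (repr u)^-1.

Let repr_pi x : N (repr (pi x) * x^-1). Proof. by apply/piP; rewrite piK. Qed.

Let qmE x y : qm (pi x) (pi y) = pi (x * y).
Proof.
apply/eqP/piP; rewrite invgM mulgA -(mulgA (repr (pi x))).
have := NM (nN (I : setT (repr (pi x))) (repr_pi y)) (repr_pi x).
by rewrite !mulgA mulgVK.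
Qed.

Let qvE x : qv (pi x) = pi x^-1.
Proof.
apply/eqP/piP; rewrite invgK.
by have := nN (I : setT x^-1) (NV (repr_pi x)); rewrite !(invgM, invgK) mulgA mulVg mul1g.
Qed.

Let qind (P : Q -> Prop) : (forall x, P (pi x)) -> forall u, P u.
Proof. by move=> Ppi u; rewrite -[u]piK. Qed.

Let qA : associative qm.
Proof. by elim/qind=> x; elim/qind=> y; elim/qind=> z; rewrite !qmE mulgA. Qed.
Let q1m : left_id (pi 1) qm.
Proof. by elim/qind=> x; rewrite qmE mul1g. Qed.
Let qm1 : right_id (pi 1) qm.
Proof. by elim/qind=> x; rewrite qmE mulg1. Qed.
Let qV : left_inverse (pi 1) qv qm.
Proof. by elim/qind=> x; rewrite qvE qmE mulVg. Qed.
Let qmV : right_inverse (pi 1) qv qm.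
Proof. by elim/qind=> x; rewrite qvE qmE mulgV. Qed.

HB.instance Definition _ := Choice.on Q.
HB.instance Definition _ := isGroup.Build Q qA q1m qm1 qV qmV.

(** Congruences modulo [N] become equations in [D]; only the homomorphism and its kernel are
    exported. *)
Lemma quotient_group_exists : exists (D : groupType) (p : G -> D),
  (forall x y, p (x * y) = p x * p y) /\ (forall x, p x = 1 <-> N x).
Proof.
exists (Q : groupType), pi; split=> [x y|x]; first by rewrite -qmE.
split=> [/eqP/piP|Nx]; first by rewrite invg1 mulg1.
by apply/eqP/piP; rewrite invg1 mulg1.
Qed.

End QuotientGroup.

Section Commutation.
Variable G : groupType.
Implicit Types u v w x y z : G.
Local Open Scope group_scope.

Lemma conj_fix x y : commute x y -> x * y * x^-1 = y.
Proof. by move=> ->; rewrite mulgK. Qed.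

Lemma commute_conj x y : commute x y -> y^-1 * x * y = x.
Proof. by move=> xy; rewrite -mulgA xy mulKg. Qed.

Lemma eq_mulr x y z : x * y = z -> forall t, x * (y * t) = z * t.
Proof. by move=> <- t; rewrite mulgA. Qed.

Lemma commuteVl x y : commute x y -> commute x^-1 y.
Proof. by move=> xy; apply/commute_sym/commuteV/commute_sym. Qed.

Lemma commute_comm x y z : commute x y -> commute x z -> commute x (comm y z).
Proof. by move=> xy xz; rewrite /comm; do ![apply: commuteM|apply: commuteV]. Qed.

(* If conjugation by u multiplies z by w and everything else commutes, then
   the two contributions of u to the conjugate of z by [u, v] cancel. *)
Lemma comm_commute u v w z : u * z * u^-1 = w * z ->
  commute u w -> commute v z -> commute v w -> commute (comm u v) z.
Proof.
move=> uz uw vz vw; have wu : commute w^-1 u := commuteVl (commute_sym uw).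
have e6 : u * z = w * z * u by rewrite -uz mulgVK.
have e1 : u^-1 * z = w^-1 * z * u^-1.
  apply: (mulgI u); apply: (mulIg u); rewrite mulVKg !mulgA mulgVK.
  by rewrite -wu -mulgA e6 -!mulgA mulKg.
have e2 := commuteVl vz; have e3 := commuteV vw.
rewrite /commute /comm -!mulgA e2 (eq_mulr e1) -!mulgA (eq_mulr e3) -!mulgA.
rewrite (eq_mulr vz) -!mulgA (eq_mulr (commute_sym wu)) -!mulgA.
by rewrite (eq_mulr e6) -!mulgA mulKg.
Qed.

(* A form of the Hall-Witt identity. *)
Lemma comm_comm_shift x y z A Y :
    z * x * z^-1 = A * x -> z * y * z^-1 = Y^-1 * y ->
    commute x A -> commute y A -> commute Y A -> commute y Y ->
    commute y (comm x^-1 Y^-1) ->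
  comm (comm x y) z = comm Y^-1 x.
Proof.
move=> zx zy xA yA YA yY yh.
have -> : comm (comm x y) z = comm x y * comm (Y^-1 * y) (A * x).
  rewrite -zx -zy -comm_conj -[comm y x]comm_inv.
  by rewrite {1}/comm !mulgA.
have h : x * (y * comm x^-1 Y^-1 * y^-1) * x^-1 = comm Y^-1 x.
  by rewrite yh mulgK /comm !invgK !mulgA mulgV mul1g.
rewrite -h /comm !(invgM, invgK) -!mulgA.
rewrite (eq_mulr (commuteVl (commuteV yY))) -!mulgA mulKg.
rewrite (eq_mulr (commute_sym xA)) -!mulgA.
rewrite (eq_mulr (commute_sym (commuteVl yA))) -!mulgA.
rewrite (eq_mulr (commute_sym YA)) -!mulgA.
rewrite (eq_mulr (commute_sym (commuteVl xA))) -!mulgA mulgV mulg1.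
by rewrite (eq_mulr (commuteVl yY)) -!mulgA.
Qed.

(** The factors [x1] and [y1], fixed by [z], do not contribute. By [F], the double commutator
    depends only on A, B, the conjugate of B by x, and the conjugation of BA by x y x^-1. Adding
    [x1] and [y1] multiplies x y x^-1 on the right by [k], which commutes with both A and B. *)
Lemma comm_comm_reduce x0 x1 y0 y1 z A B :
    z * x0 * z^-1 = A * x0 -> commute z x1 ->
    z * y0 * z^-1 = B * y0 -> commute z y1 ->
    commute x0 A -> commute x1 A -> commute y1 A ->
    commute y0 B -> commute y1 B -> commute x1 B ->
    commute x1 (comm y0 A) ->
    commute (x0 * (y0^-1 * x1 * y0 * y1 * x1^-1) * x0^-1) B ->
  comm (comm (x0 * x1) (y0 * y1)) z = comm (comm x0 y0) z.
Proof.
move=> zx0 zx1 zy0 zy1 x0A x1A y1A y0B y1B x1B x1yA kB.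
have F x y : z * x * z^-1 = A * x -> z * y * z^-1 = B * y ->
    commute x A -> commute y B ->
    comm (comm x y) z = x * y * x^-1 * (B * A) * (x * y * x^-1)^-1
                          * (x * B * x^-1)^-1 * A^-1.
  move=> zx zy xA yB.
  have -> : comm (comm x y) z = comm x y * comm (B * y) (A * x).
    rewrite -zx -zy -comm_conj -[comm y x]comm_inv.
    by rewrite {1}/comm !mulgA.
  rewrite /comm !(invgM, invgK) -!mulgA.
  rewrite (eq_mulr (commuteVl yB)) -!mulgA mulKg.
  by rewrite !mulKg.
have Az : z * (x0 * x1) * z^-1 = A * (x0 * x1).
  by rewrite (mulgA A) -zx0 -!mulgA (commuteVl zx1).
have Bz : z * (y0 * y1) * z^-1 = B * (y0 * y1).
  by rewrite (mulgA B) -zy0 -!mulgA (commuteVl zy1).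
have xA : commute (x0 * x1) A.
  by apply/commute_sym/commuteM; apply: commute_sym.
have yB : commute (y0 * y1) B.
  by apply/commute_sym/commuteM; apply: commute_sym.
rewrite (F _ _ Az Bz xA yB) (F _ _ zx0 zy0 x0A y0B).
have -> : x0 * x1 * B * (x0 * x1)^-1 = x0 * B * x0^-1.
  by rewrite invgM -!mulgA (mulgA B) (commuteV (commute_sym x1B)) -mulgA mulVKg.
congr (_ * _ * _); set k := x0 * _ * _ in kB.
have -> : x0 * x1 * (y0 * y1) * (x0 * x1)^-1 = x0 * y0 * x0^-1 * k.
  by rewrite /k invgM -!mulgA mulKg mulVKg.
have kA : commute k A.
  apply: commute_sym; have Ax0 := commute_sym x0A.
  have x1yAy : commute x1 (y0 * A * y0^-1).
    by rewrite -(mulgVK A (_ * _)) -/(comm y0 A); apply: commuteM.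
  have Ay : commute A (y0^-1 * x1 * y0).
    rewrite /commute -[A in LHS](mulKg y0) -!mulgA.
    congr (_ * _); apply: (mulIg y0^-1); rewrite -!mulgA mulgV mulg1.
    by move: x1yAy; rewrite /commute -!mulgA => ->.
  apply: commuteM (commuteV Ax0); apply: commuteM => //.
  apply: commuteM (commuteV (commute_sym x1A)).
  exact: commuteM Ay (commute_sym y1A).
clearbody k; rewrite invgM -!mulgA (eq_mulr kB) -!mulgA (eq_mulr kA) -!mulgA.
by rewrite mulVKg.
Qed.
End Commutation.

(** * Elementary commutators in a group with Steinberg relations *)

(** Only the relations are kept, so that the identities below apply to the images of [el] in
    quotients of GL(n, A). *)
Definition steinberg (n : nat) (A : pzRingType) (G : groupType)
    (e : 'I_n -> 'I_n -> A -> G) :=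
  [/\ forall i j a b, i != j -> e i j (a + b) = (e i j a * e i j b)%g,
      forall i j k l a b, i != j -> k != l -> j != k -> i != l ->
        commute (e i j a) (e k l b) &
      forall i j k a b, i != j -> j != k -> i != k ->
        comm (e i j a) (e j k b) = e i k (a * b)].

Section Steinberg.
Variables (n : nat) (A : pzRingType) (G : groupType).
Variable e : 'I_n -> 'I_n -> A -> G.
Hypotheses (n3 : (3 <= n)%N) (St : steinberg e).
Implicit Types (i j l m : 'I_n).
Local Open Scope group_scope.

Lemma stD i j (a b : A) : i != j -> e i j (a + b)%R = e i j a * e i j b.
Proof. by have [+ _ _] := St; apply. Qed.

Lemma stC i j k l (a b : A) : i != j -> k != l -> j != k -> i != l ->
  commute (e i j a) (e k l b).
Proof. by have [_ + _] := St; apply. Qed.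

Lemma stS i j k (a b : A) : i != j -> j != k -> i != k ->
  comm (e i j a) (e j k b) = e i k (a * b)%R.
Proof. by have [_ _ +] := St; apply. Qed.

Lemma st0 i j : i != j -> e i j 0 = 1.
Proof. by move=> ij; apply: (mulgI (e i j 0)); rewrite -stD // addr0 mulg1. Qed.

Lemma stN i j (a : A) : i != j -> e i j (- a)%R = (e i j a)^-1.
Proof.
by move=> ij; apply: (mulgI (e i j a)); rewrite -stD // subrr st0 // mulgV.
Qed.

Lemma st_conjl i j k (a b : A) : i != j -> j != k -> i != k ->
  e i j a * e j k b * (e i j a)^-1 = e i k (a * b)%R * e j k b.
Proof. by move=> ij jk ik; rewrite -(stS _ _ ij jk ik) /comm mulgVK. Qed.

Lemma st_conjr i j k (a b : A) : i != j -> j != k -> i != k ->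
  e j k b * e i j a * (e j k b)^-1 = e i k (- (a * b))%R * e i j a.
Proof.
by move=> ij jk ik; rewrite stN // -(stS _ _ ij jk ik) comm_inv /comm mulgVK.
Qed.

Definition ecomm i j (a b : A) := comm (e i j a) (e j i b).

Lemma ecommV i j (a b : A) : (ecomm i j a b)^-1 = ecomm j i b a.
Proof. exact: comm_inv. Qed.

Lemma ecomm_commute_sym i j (a b : A) x : commute x (ecomm i j a b) -> commute x (ecomm j i b a).
Proof. by move=> xy; rewrite -ecommV; apply: commuteV. Qed.

(** When exactly one of [k], [l] lies in {i, j}, [comm_commute] leaves a single obstruction, an
    elementary element whose entry has a factor a b or b a; these are trivial by hypothesis. *)
Lemma ecomm_commute_st i j k l (a b c : A) : i != j -> k != l ->
    (forall p q x, p != q -> e p q (a * b * x)%R = 1) ->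
    (forall p q x, p != q -> e p q (x * (a * b))%R = 1) ->
    (forall p q x, p != q -> e p q (b * a * x)%R = 1) ->
    (forall p q x, p != q -> e p q (x * (b * a))%R = 1) ->
  commute (ecomm i j a b) (e k l c).
Proof.
have row p q m (a' b' c' : A) : p != q -> m != p -> m != q ->
    (forall p q x, p != q -> e p q (b' * a' * x)%R = 1) ->
    commute (ecomm p q a' b') (e q m c').
  move=> pq mp mq b0; have qp : q != p by rewrite eq_sym.
  have pm : p != m by rewrite eq_sym.
  have qm : q != m by rewrite eq_sym.
  apply: (comm_commute (w := e p m (a' * c')%R)).
  - exact: st_conjl.
  - exact: stC.
  - exact: stC.
  - by apply/comm_eq1; rewrite stS // mulrA b0.
have col p q m (a' b' c' : A) : p != q -> m != p -> m != q ->
    (forall p q x, p != q -> e p q (x * (a' * b'))%R = 1) ->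
    commute (ecomm p q a' b') (e m p c').
  move=> pq mp mq b0; have qp : q != p by rewrite eq_sym.
  have pm : p != m by rewrite eq_sym.
  have qm : q != m by rewrite eq_sym.
  apply: (comm_commute (w := e m q (- (c' * a'))%R)).
  - exact: st_conjr.
  - by apply: stC.
  - by apply: stC.
  - apply/commute_sym/comm_eq1; rewrite stS // mulNr -mulrA -mulNr.
    by rewrite b0.
move=> ij kl ab0 ab0' ba0 ba0'.
have ji : j != i by rewrite eq_sym.
have outside k' l' (c' : A) : k' != l' ->
    ((k' != i) && (k' != j)) || ((l' != i) && (l' != j)) ->
    commute (ecomm i j a b) (e k' l' c').
  move=> kl'; case/orP => [/andP[ki kj]|/andP[li lj]].
    have [li|li] := eqVneq l' i; first by rewrite li; apply: col.
    have [lj|lj] := eqVneq l' j.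
      rewrite lj; apply/commute_sym/ecomm_commute_sym/commute_sym.
      by apply: col.
    by apply/commute_sym/commute_comm; apply: stC; rewrite // eq_sym.
  have [ki|ki] := eqVneq k' i.
    rewrite ki; apply/commute_sym/ecomm_commute_sym/commute_sym.
    by apply: row.
  have [kj|kj] := eqVneq k' j; first by rewrite kj; apply: row.
  by apply/commute_sym/commute_comm; apply: stC; rewrite // eq_sym.
have [out|inn] := boolP (((k != i) && (k != j)) || ((l != i) && (l != j))).
  exact: outside.
(* Inside the block, [e_kl] is a commutator of elements outside. *)
have [m /andP[mi mj]] := third_index i j n3.
have [mk ml] : m != k /\ m != l.
  move: inn; rewrite negb_or !negb_and !negbK => /andP[].
  by move=> /orP[] /eqP-> /orP[] /eqP->.
have km : k != m by rewrite eq_sym.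
rewrite -[c]mulr1 -(stS _ _ km ml kl).
by apply: commute_comm; apply: outside; rewrite // mi mj ?orbT.
Qed.


(* In the application Kp and Hp are the images of a relative elementary group
   E(n, A, K) and of a mixed commutator subgroup [E(n, A, I), E(n, A, J)] in a
   quotient in which they commute. *)
Record pairing (I J K : two_sided_ideal A) (Kp Hp : G -> Prop) : Prop := Pairing {
  pairing_KM : forall x z, Kp x -> Kp z -> Kp (x * z);
  pairing_KV : forall x, Kp x -> Kp x^-1;
  pairing_KJ : forall i j c x, i != j -> Kp x -> Kp (e i j c * x * (e i j c)^-1);
  pairing_KE : forall i j k, i != j -> K k -> Kp (e i j k);
  pairing_KH : forall x h, Kp x -> Hp h -> commute x h;
  pairing_Hy : forall i j a b, i != j -> I a -> J b -> Hp (ecomm i j a b);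
  pairing_HIJ : forall i j a b, i != j -> I a -> J b -> Hp (e i j (a * b)%R);
  pairing_HJI : forall i j a b, i != j -> I a -> J b -> Hp (e i j (b * a)%R) }.

Section Pairing.
Variables (I J K : two_sided_ideal A) (Kp Hp : G -> Prop).
Hypothesis PD : pairing I J K Kp Hp.

Let KpM x z : Kp x -> Kp z -> Kp (x * z). Proof. exact: pairing_KM PD x z. Qed.
Let KpV x : Kp x -> Kp x^-1. Proof. exact: pairing_KV PD x. Qed.
Let KpJ i j c x : i != j -> Kp x -> Kp (e i j c * x * (e i j c)^-1).
Proof. exact: pairing_KJ PD i j c x. Qed.
Let KpE i j k : i != j -> K k -> Kp (e i j k).
Proof. exact: pairing_KE PD i j k. Qed.
Let KH x h : Kp x -> Hp h -> commute x h. Proof. exact: pairing_KH PD x h. Qed.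
Let Hy i j a b : i != j -> I a -> J b -> Hp (ecomm i j a b).
Proof. exact: pairing_Hy PD i j a b. Qed.
Let HIJ i j a b : i != j -> I a -> J b -> Hp (e i j (a * b)%R).
Proof. exact: pairing_HIJ PD i j a b. Qed.
Let HJI i j a b : i != j -> I a -> J b -> Hp (e i j (b * a)%R).
Proof. exact: pairing_HJI PD i j a b. Qed.

(** Through a third index the element is the commutator of a member of [Kp] and one of [Hp]. The
    next three lemmas are its variants. *)
Lemma st_K_IJ i j (k a b : A) : i != j -> K k -> I a -> J b -> e i j (k * (a * b))%R = 1.
Proof.
move=> ij Kk Ia Jb; have [m /andP[mi mj]] := third_index i j n3.
have im : i != m by rewrite eq_sym.
rewrite -(stS _ _ im mj ij); apply/comm_eq1; apply: KH; first exact: KpE.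
exact: HIJ.
Qed.

Lemma st_IJ_K i j (k a b : A) : i != j -> K k -> I a -> J b -> e i j (a * b * k)%R = 1.
Proof.
move=> ij Kk Ia Jb; have [m /andP[mi mj]] := third_index i j n3.
have im : i != m by rewrite eq_sym.
rewrite -(stS _ _ im mj ij); apply/comm_eq1/commute_sym; apply: KH; first exact: KpE.
exact: HIJ.
Qed.

Lemma st_JI_K i j (k a b : A) : i != j -> K k -> I a -> J b -> e i j (b * a * k)%R = 1.
Proof.
move=> ij Kk Ia Jb; have [m /andP[mi mj]] := third_index i j n3.
have im : i != m by rewrite eq_sym.
rewrite -(stS _ _ im mj ij); apply/comm_eq1/commute_sym; apply: KH; first exact: KpE.
exact: HJI.
Qed.

Lemma st_K_JI i j (k a b : A) : i != j -> K k -> I a -> J b -> e i j (k * (b * a))%R = 1.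
Proof.
move=> ij Kk Ia Jb; have [m /andP[mi mj]] := third_index i j n3.
have im : i != m by rewrite eq_sym.
rewrite -(stS _ _ im mj ij); apply/comm_eq1; apply: KH; first exact: KpE.
exact: HJI.
Qed.

Let KHs x h : Kp x -> Hp h -> commute h x.
Proof. by move=> *; apply/commute_sym/KH. Qed.

Lemma Kp_conjV i j c x : i != j -> Kp x -> Kp ((e i j c)^-1 * x * e i j c).
Proof. by move=> ij Kx; rewrite -[e i j c]invgK -stN // invgK; apply: KpJ. Qed.

(** Write e_ij(a k) = [e_im(a), e_mj(k)] and apply [comm_comm_shift]. The corrections e_jm(b a) and
    e_mi(k b) lie in [Hp] and [Kp], so they commute with each other. *)
Lemma ecomm_shift i j m (a b k : A) : i != j -> m != i -> m != j ->
  I a -> J b -> K k -> ecomm i j (a * k)%R b = ecomm i m a (k * b)%R.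
Proof.
move=> ij mi mj Ia Jb Kk; have im : i != m by rewrite eq_sym.
have ji : j != i by rewrite eq_sym.
have jm : j != m by rewrite eq_sym.
have Kkb : K (k * b)%R by apply: Defs.idealMr.
have Jkb : J (k * b)%R by apply: idealMl.
have HA : Hp (e j m (b * a)%R) by apply: HJI.
have yc : Hp (ecomm i m a (k * b)%R) by apply: Hy.
rewrite {1}/ecomm -(stS _ _ im mj ij).
rewrite (comm_comm_shift (A := e j m (b * a)%R) (Y := e m i (k * b)%R)).
- have -> : comm (e m i (k * b)%R)^-1 (e i m a)
          = (e m i (k * b)%R)^-1 * ecomm i m a (k * b)%R * e m i (k * b)%R.
    by rewrite /ecomm /comm !(invgM, invgK) !mulgA mulgVK.
  by rewrite commute_conj //; apply: KHs yc; apply: KpE.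
- exact: st_conjl.
- by rewrite st_conjr // stN.
- exact: stC.
- by apply: KH HA; apply: KpE.
- by apply: KH HA; apply: KpE.
- exact: stC.
- rewrite -!stN //; apply: KH; first exact: KpE.
  by apply: Hy => //; apply: idealN.
Qed.

(** Additivity needs the added term in [K]: the conjugating element then lies in [Kp] and fixes
    [Hp]. *)
Lemma ecomm_addr i j (a b b' : A) : i != j -> I a -> J b -> J b' -> K b' ->
  ecomm i j a (b' + b)%R = ecomm i j a b' * ecomm i j a b.
Proof.
move=> ij Ia Jb Jb' Kb'; have ji : j != i by rewrite eq_sym.
rewrite /ecomm stD // comm_mulr conj_fix //.
by apply: KH; [apply: KpE|apply: Hy].
Qed.

Lemma ecomm_addl i j (a a' b : A) : i != j -> I a -> I a' -> J b -> K a' ->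
  ecomm i j (a' + a)%R b = ecomm i j a b * ecomm i j a' b.
Proof.
move=> ij Ia Ia' Jb Ka'; have ji : j != i by rewrite eq_sym.
rewrite /ecomm stD // comm_mull conj_fix //.
by apply: KH; [apply: KpE|apply: Hy].
Qed.

(** Here e_ij(a k) = [e_im(a k), e_mj(1)], and the correction e_jm(b a k) in [comm_comm_shift] is
    trivial. *)
Lemma ecomm_K_transport i j m (a b k : A) : i != j -> m != i -> m != j ->
  I a -> J b -> K k -> ecomm i j (a * k)%R b = ecomm i m (a * k)%R b.
Proof.
move=> ij mi mj Ia Jb Kk; have im : i != m by rewrite eq_sym.
have ji : j != i by rewrite eq_sym.
have jm : j != m by rewrite eq_sym.
transitivity (comm (e m i b)^-1 (e i m (a * k)%R)).
  rewrite {1}/ecomm -[(a * k)%R in LHS]mulr1 -(stS _ _ im mj ij).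
  apply: (comm_comm_shift (A := 1)).
  - by rewrite st_conjl // mulrA st_JI_K.
  - by rewrite st_conjr // mul1r stN.
  - exact: commute1.
  - exact: commute1.
  - exact: commute1.
  - exact: stC.
  rewrite -!stN //; apply/commute_sym; apply: (comm_commute (w := e i j (- (a * k))%R)).
  - by rewrite st_conjl // mulr1.
  - exact: stC.
  - exact: stC.
  - apply/comm_eq1; rewrite stS // mulrNN mulrA.
    exact: st_JI_K.
have mj' : m != j by [].
(* Additivity in the second argument requires an entry in [K], so [k] is first shifted over
   there. *)
have neg : ecomm i m (a * k)%R (- b)%R = (ecomm i m (a * k)%R b)^-1.
  rewrite !(ecomm_shift im ji jm) //; last exact: idealN.
  apply: (mulIg (ecomm i j a (k * b)%R)); rewrite mulVg mulrN.
  rewrite -ecomm_addr //; first 1 last.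
  - exact: idealMl.
  - by apply/idealN/idealMl.
  - by apply/idealN/Defs.idealMr.
  by rewrite addNr /ecomm st0 // comm_1r.
by rewrite -stN // -comm_inv -/(ecomm i m _ _) neg invgK.
Qed.

(** With u = k + 1 both sides split by additivity into the same two commuting factors, because
    y_ij(a, k b) = y_im(a k, b) = y_ij(a k, b). *)
Lemma ecomm_unit i j (a b u : A) : i != j -> I a -> J b -> K (u - 1)%R ->
  ecomm i j (a * u)%R b = ecomm i j a (u * b)%R.
Proof.
move=> ij Ia Jb Ku; have [m /andP[mi mj]] := third_index i j n3.
have im : i != m by rewrite eq_sym.
have ji : j != i by rewrite eq_sym.
have jm : j != m by rewrite eq_sym.
have -> : (u = (u - 1) + 1)%R by rewrite subrK.
move: (u - 1)%R Ku => k Ku.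
rewrite !mulrDr mulrDl mulr1 mul1r.
rewrite ecomm_addr //; last 2 first.
- exact: idealMl.
- exact: Defs.idealMr.
rewrite -(ecomm_shift im ji jm) // -(ecomm_K_transport ij mi mj) //.
have Kak : K (a * k)%R by apply: idealMl.
rewrite (ecomm_addl ij Ia _ Jb Kak); last exact: Defs.idealMr.
apply: KHs; last exact: Hy.
rewrite /ecomm /comm -!mulgA; apply: KpM; first exact: KpE.
by rewrite mulgA; apply: KpJ => //; apply/KpV/KpE.
Qed.

(* Only the corner entry of the rank-one matrix of [unip_block] matters. *)
Lemma ecomm_block i j m (a b d k d' k' : A) : i != j -> m != i -> m != j ->
    I a -> J b -> K k -> K k' ->
  comm (comm (e i m d * e j m k) (e m j (a * d')%R * e m i (- (a * k'))%R)) (e j i b)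
  = ecomm i j (d * a * d')%R b.
Proof.
move=> ij mi mj Ia Jb Kk Kk'; have im : i != m by rewrite eq_sym.
have ji : j != i by rewrite eq_sym.
have jm : j != m by rewrite eq_sym.
have Iad : I (a * d')%R by apply: Defs.idealMr.
have Kak : K (- (a * k'))%R by apply/idealN/idealMl.
have HB : Hp (e m i (- (a * d' * b))%R).
  by rewrite -mulrN; apply: HIJ => //; apply: idealN.
have KJ i1 j1 c x : i1 != j1 -> Kp x -> Kp ((e i1 j1 c)^-1 * x * e i1 j1 c).
  exact: Kp_conjV.
rewrite (comm_comm_reduce (A := e j m (b * d)%R) (B := e m i (- (a * d' * b))%R)).
- by rewrite stS // mulrA.
- exact: st_conjl.
- exact: stC.
- exact: st_conjr.
- exact: stC.
- exact: stC.
- exact: stC.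
- apply/commute_sym/comm_eq1; rewrite stS // mulrN -mulrA.
  rewrite -!mulrN !mulrA -(mulrA b d).
  by apply: st_JI_K => //; [apply: idealN|apply: idealMl].
- exact: stC.
- exact: stC.
- by apply: KH HB; apply: KpE.
- by apply: KH; [apply: KpE|apply: Hy => //; apply: Defs.idealMr].
- apply: KH HB; apply: (KpJ) => //; apply: (KpM); last by apply: (KpV); apply: KpE.
  by apply: KpM; [apply: KJ => //; apply: KpE|apply: KpE].
Qed.

End Pairing.

(** Exchanging [I] and [J] inverts the elementary commutators. As [Hp] need not be closed under
    inverses, it is replaced by the centralizer of [Kp]. *)
Lemma pairing_sym (I J K : two_sided_ideal A) (Kp Hp : G -> Prop) :
  pairing I J K Kp Hp ->
  pairing J I K Kp (fun h => forall x, Kp x -> commute x h).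
Proof.
move=> [KM KV KJ KE KH Hy HIJ HJI]; split=> // [x h Kx|i j b a ij Jb Ia x Kx||].
- exact.
- by apply: ecomm_commute_sym; apply: KH => //; apply: Hy; rewrite // eq_sym.
- by move=> i j b a ij Jb Ia x Kx; apply: KH => //; apply: HJI.
- by move=> i j b a ij Jb Ia x Kx; apply: KH => //; apply: HIJ.
Qed.

End Steinberg.

(** * Mixed commutator subgroups *)

Definition unit_ideal (A : pzRingType) : two_sided_ideal A :=
  @TwoSidedIdeal A (fun=> True) I (fun _ _ _ _ => I) (fun _ _ _ => I)
    (fun _ _ _ => I).

Section ProductIdeal.
Variables (A : pzRingType) (I J : two_sided_ideal A).

(** Membership in the ideal IJ + JI. *)
Definition in_sym_product (x : A) : Prop := forall L : two_sided_ideal A,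
  (forall a b, I a -> J b -> L (a * b) /\ L (b * a)) -> L x.

Lemma sym_product0 : in_sym_product 0.
Proof. by move=> L _; apply: ideal0. Qed.
Lemma sym_productD x y :
  in_sym_product x -> in_sym_product y -> in_sym_product (x + y).
Proof. by move=> Lx Ly L LIJ; apply: idealD; [apply: Lx|apply: Ly]. Qed.
Lemma sym_productMl a x : in_sym_product x -> in_sym_product (a * x).
Proof. by move=> Lx L LIJ; apply: idealMl; apply: Lx. Qed.
Lemma sym_productMr a x : in_sym_product x -> in_sym_product (x * a).
Proof. by move=> Lx L LIJ; apply: Defs.idealMr; apply: Lx. Qed.

Definition sym_product : two_sided_ideal A :=
  TwoSidedIdeal sym_product0 sym_productD sym_productMl sym_productMr.

Lemma sym_product_l a b : I a -> J b -> sym_product (a * b).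
Proof. by move=> Ia Jb L LIJ; have [] := LIJ a b Ia Jb. Qed.
Lemma sym_product_r a b : I a -> J b -> sym_product (b * a).
Proof. by move=> Ia Jb L LIJ; have [] := LIJ a b Ia Jb. Qed.

End ProductIdeal.

Section Normality.
Variables (n : nat) (A : pzRingType).
Hypotheses (n3 : (3 <= n)%N) (hA : quasi_finite_ring A).
Implicit Types (I J K L : two_sided_ideal A) (i j l m : 'I_n) (g h : GL n A).
Notation cong I := (principal_congruence_subgroup n I).
Notation Eg := (elementary_group n A).
Notation rel I := (relative_elementary_group n I).
Local Open Scope group_scope.

Lemma cong_unit_ideal g : cong (unit_ideal A) g.
Proof. exact/congP. Qed.

(** This is [comm_el_cong] for the unit ideal, whose congruence subgroup is all of GL(n, A). *)
Lemma rel_normal_GL I : normalizes setT (rel I).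
Proof.
move=> g x _ Ix; have [I1 IM IV] := rel_subgroup n I.
have nI := @rel_normal n A I.
have HI i j a b : i != j -> I a -> unit_ideal A b -> rel I (el i j (a * b)%R).
  by move=> ij Ia _; apply: el_rel => //; apply: Defs.idealMr.
have HI' i j a b : i != j -> I a -> unit_ideal A b -> rel I (el i j (b * a)%R).
  by move=> ij Ia _; apply: el_rel => //; apply: idealMl.
have Hy i j a b : i != j -> I a -> unit_ideal A b ->
    rel I (comm (el i j a) (el j i b)).
  move=> ij Ia _; rewrite /comm -!mulgA; apply: IM; first exact: el_rel.
  rewrite mulgA; apply: nI; first by apply: el_Eg; rewrite eq_sym.
  by apply: IV; apply: el_rel.
suff relJ : forall g, rel I (g * x * g^-1) by [].
apply: (rel_min (I := I) (H := fun z => forall g, rel I (g * z * g^-1))) Ix.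
- split=> [h|z z' Iz Iz' h|z Iz h].
  + by rewrite mulg1 mulgV.
  + by have := IM _ _ (Iz h) (Iz' h); rewrite !mulgA mulgVK.
  + by have := IV _ (Iz h); rewrite !(invgM, invgK) mulgA.
- by move=> k z _ Iz h; have := Iz (h * k); rewrite invgM !mulgA.
move=> i j a ij Ia h.
have Ina : I (- a)%R by apply: idealN.
have := comm_el_cong n3 (rel_subgroup n I) nI HI HI' Hy hA ij Ina (cong_unit_ideal h).
move=> /(IM _ _ (el_rel ij Ia)); rewrite /comm elN // invgK !mulgA mulgV mul1g.
done.
Qed.

Section TwoIdeals.
Variables I J : two_sided_ideal A.

Lemma sub_normal_commgs : normalizes setT (commgs (rel I) (rel J)).
Proof. by apply: normalizes_commgs; apply: rel_normal_GL. Qed.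

(** The entries [x] for which all e_ij(x) lie in [H] form an ideal, since [H] is normal and e_ij(c
    x) = [e_im(c), e_mj(x)]. The same relation puts the products of [I] and [J] in it. *)
Lemma rel_sym_product_sub x :
  rel (sym_product I J) x -> commgs (rel I) (rel J) x.
Proof.
set H := commgs _ _; have [H1 HM HV] : is_subgroup H by apply: commgs_subgroup.
have nH : normalizes setT H := sub_normal_commgs.
move: x; apply: rel_min => // [k h _|i j a ij La]; first exact: nH.
pose X x := forall i j, i != j -> H (el i j x).
have X0 : X 0 by move=> i' j' _; rewrite el0.
have XD x y : X x -> X y -> X (x + y)%R.
  by move=> Xx Xy i' j' ij'; rewrite elD //; apply: HM; [apply: Xx|apply: Xy].
have Hc x y : H y -> H (comm x y).
  by move=> Hy; apply: HM; [apply: nH|apply: HV].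
have XMl c x : X x -> X (c * x)%R.
  move=> Xx i' j' ij'; have [m /andP[mi mj]] := third_index i' j' n3.
  have im : i' != m by rewrite eq_sym.
  by rewrite -(el_st c x im mj ij'); apply: Hc; apply: Xx.
have XMr c x : X x -> X (x * c)%R.
  move=> Xx i' j' ij'; have [m /andP[mi mj]] := third_index i' j' n3.
  have im : i' != m by rewrite eq_sym.
  rewrite -(el_st x c im mj ij') -comm_inv; apply: HV; apply: Hc.
  by apply: Xx.
apply: (La (TwoSidedIdeal X0 XD XMl XMr)) => // c b Ic Jb.
have Xcb : X (c * b)%R.
  move=> i' j' ij'; have [m /andP[mi mj]] := third_index i' j' n3.
  have im : i' != m by rewrite eq_sym.
  rewrite -(el_st c b im mj ij').
  by apply: commgs_comm; apply: el_rel.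
split=> // i' j' ij'; have [m /andP[mi mj]] := third_index i' j' n3.
  have im : i' != m by rewrite eq_sym.
rewrite -(el_st b c im mj ij') -comm_inv; apply: HV.
by apply: commgs_comm; apply: el_rel.
Qed.

Lemma steinberg_el (D : groupType) (p : GL n A -> D) :
  (forall x y, p (x * y) = p x * p y) -> steinberg (fun i j a => p (el i j a)).
Proof.
move=> pM; have p1 := hom_group1 pM.
have pV := hom_groupV pM.
split=> [i j a b ij|i j k l a b ij kl jk il|i j k a b ij jk ik].
- by rewrite elD.
- by rewrite /commute -!pM el_commM.
- by rewrite -(el_st a b ij jk ik) /comm !pM !pV.
Qed.

Local Notation N := (rel (sym_product I J)).
Local Notation yel i j a b := (comm (el i j a) (el j i b)).

Lemma yel_central_hom (D : groupType) (p : GL n A -> D) :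
    (forall x y, p (x * y) = p x * p y) -> (forall x, p x = 1 <-> N x) ->
  forall i j a b z, i != j -> I a -> J b -> Eg z -> commute (p z) (p (yel i j a b)).
Proof.
move=> pM pN i j a b z ij Ia Jb Ez; have St := steinberg_el pM.
have p1 := hom_group1 pM.
have pV := hom_groupV pM.
have pL i' j' x : i' != j' -> sym_product I J x -> p (el i' j' x) = 1.
  by move=> ij' Lx; apply/pN; apply: el_rel.
move: z Ez; apply: gen_min.
  split=> [|x x' cx cx'|x cx].
  - by rewrite p1; apply: commute_sym; apply: commute1.
  - by rewrite pM; apply/commute_sym/commuteM; apply: commute_sym.
  - by rewrite pV; apply: commuteVl.
move=> _ [k [l [kl [c ->]]]]; rewrite elE; apply: commute_sym.
rewrite hom_comm //; apply: (ecomm_commute_st n3 St c ij kl) => k' l' x kl'.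
- by apply: pL => //; apply: Defs.idealMr; apply: sym_product_l.
- by apply: pL => //; apply: idealMl; apply: sym_product_l.
- by apply: pL => //; apply: Defs.idealMr; apply: sym_product_r.
- by apply: pL => //; apply: idealMl; apply: sym_product_r.
Qed.

Lemma yel_central i j a b z : i != j -> I a -> J b -> Eg z ->
  N (comm z (yel i j a b)).
Proof.
move=> ij Ia Jb Ez.
have [D [p [pM pN]]] := quotient_group_exists (rel_subgroup n (sym_product I J))
  (rel_normal_GL (I := sym_product I J)).
by apply/pN; rewrite hom_comm //; apply/comm_eq1/yel_central_hom.
Qed.

(** Modulo [N] the elementary commutators are central in the image of [Eg], so [ecomm_shift] is
    available with the unit ideal for [K] and hence for every [c]. It leads from [j] to [m], and its
    case c = 1 leads back. *)
Lemma yel_shift i j a b c : i != j -> I a -> J b ->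
  N (yel i j (a * c)%R b * (yel i j a (c * b)%R)^-1).
Proof.
move=> ij Ia Jb.
have [D [p [pM pN]]] := quotient_group_exists (rel_subgroup n (sym_product I J))
  (rel_normal_GL (I := sym_product I J)).
have p1 := hom_group1 pM.
have pV := hom_groupV pM.
apply/pN; rewrite pM pV; suff -> : p (yel i j (a * c)%R b) = p (yel i j a (c * b)%R).
  by rewrite mulgV.
have [m /andP[mi mj]] := third_index i j n3.
pose Kp x := exists2 g, Eg g & x = p g.
pose Hp (h : D) := forall x, Kp x -> commute x h.
have pL i' j' x : i' != j' -> sym_product I J x -> p (el i' j' x) = 1.
  by move=> ij' Lx; apply/pN; apply: el_rel.
have shift k b' : J b' -> p (yel i j (a * k)%R b') = p (yel i m a (k * b')%R).
  move=> Jb'.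
  rewrite !hom_comm //.
  apply: (ecomm_shift (steinberg_el pM) (K := unit_ideal A) (Kp := Kp) (Hp := Hp) _
            ij mi mj Ia Jb') => //.
  have [E1 EM EV] := Eg_subgroup n A.
  split=> [_ _ [u Eu ->] [v Ev ->]|_ [u Eu ->]|i' j' d _ ij' [u Eu ->]|||||].
  - by exists (u * v); rewrite ?pM //; apply: EM.
  - by exists u^-1; rewrite ?pV //; apply: EV.
  - exists (el i' j' d * u * (el i' j' d)^-1); last by rewrite !pM pV.
    by apply: (EM); [apply: (EM) => //; apply: el_Eg|apply: EV; apply: el_Eg].
  - by move=> i' j' k' ij' _; exists (el i' j' k') => //; apply: el_Eg.
  - by move=> x h Kx; apply.
  - move=> i' j' a' c' ij' Ia' Jc' _ [z Ez ->]; rewrite /ecomm -hom_comm //.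
    exact: yel_central_hom.
  - move=> i' j' a' c' ij' Ia' Jc' x Kx; rewrite pL //; last exact: sym_product_l.
    exact: commute1.
  - move=> i' j' a' c' ij' Ia' Jc' x Kx; rewrite pL //; last exact: sym_product_r.
    exact: commute1.
have := shift 1%R _ (idealMl c Jb); rewrite mulr1 mul1r => ->.
exact: shift.
Qed.

(** This lies between [E(n, A, I), GL(n, A, J)] and [E(n, A, I), E(n, A, J)], and so identifies
    them. *)
Definition comm_gens : set (GL n A) := gen [set g | N g \/ exists i j a b,
  [/\ i != j, I a, J b & g = yel i j a b]]%classic.

Lemma comm_gens_subgroup : is_subgroup comm_gens.
Proof. exact: gen_subgroup. Qed.

Lemma comm_gens_N x : N x -> comm_gens x.
Proof. by move=> Nx; apply: gen_incl; left. Qed.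

Lemma comm_gens_yel i j a b : i != j -> I a -> J b -> comm_gens (yel i j a b).
Proof. by move=> ij Ia Jb; apply: gen_incl; right; exists i, j, a, b. Qed.

Lemma comm_gens_normal : normalizes Eg comm_gens.
Proof.
have [_ HM _] := comm_gens_subgroup.
move=> z h Ez; apply: gen_conj => x [Nx|[i [j [a [b [ij Ia Jb ->]]]]]].
  by apply: comm_gens_N; apply: rel_normal_GL.
rewrite -[X in gen _ X](mulgVK (yel i j a b)); apply: HM.
  by apply: comm_gens_N; apply: yel_central.
exact: comm_gens_yel.
Qed.

Lemma comm_rel_cong x g : rel I x -> cong J g -> comm_gens (comm x g).
Proof.
have [H1 HM HV] := comm_gens_subgroup; have nH := comm_gens_normal.
have LN i j c : i != j -> sym_product I J c -> comm_gens (el i j c).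
  by move=> ij Lc; apply: comm_gens_N; apply: el_rel.
(* Membership in [Eg] is carried along because [comm_gens] is only known to be normalized by
   [Eg]. *)
move=> Ix; suff [] : (forall g, cong J g -> comm_gens (comm x g)) /\ Eg x.
  by move=> + _; apply.
have [E1 EM EV] := Eg_subgroup n A.
move: x Ix {g}; apply: rel_min => [|k h Ek [Hh Eh]|i j a ij Ia].
- split=> [|x z [Hx Ex] [Hz Ez]|x [Hx Ex]].
  + by split=> // g Jg; rewrite comm_1l.
  + split=> [g Jg|]; last exact: EM.
    by rewrite comm_mull; apply: HM; [apply: nH => //; apply: Hz|apply: Hx].
  + split=> [g Jg|]; last exact: EV.
    have -> : comm x^-1 g = x^-1 * (comm x g)^-1 * x^-1^-1.
      by rewrite /comm !(invgM, invgK) !mulgA mulgVK.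
    by apply: nH; [apply: EV|apply: HV; apply: Hx].
- split=> [g Jg|]; last by apply: (EM); [apply: EM|apply: EV].
  have {1}-> : g = k * (k^-1 * g * k) * k^-1 by rewrite !mulgA mulgV mul1g mulgK.
  rewrite -comm_conj; apply: nH => //; apply: Hh.
  by have := @cong_normal _ _ J setT k^-1 g Logic.I Jg; rewrite invgK.
split=> [g Jg|]; last exact: el_Eg.
apply: (comm_el_cong n3 comm_gens_subgroup nH _ _ _ hA ij Ia Jg).
- by move=> i' j' a' b' ij' Ia' Jb'; apply: LN => //; apply: sym_product_l.
- by move=> i' j' a' b' ij' Ia' Jb'; apply: LN => //; apply: sym_product_r.
- by move=> *; apply: comm_gens_yel.
Qed.

Lemma comm_gens_sub x : comm_gens x -> commgs (rel I) (rel J) x.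
Proof.
move: x; apply: gen_min; first exact: commgs_subgroup.
move=> x [Nx|[i [j [a [b [ij Ia Jb ->]]]]]]; first exact: rel_sym_product_sub.
by apply: commgs_comm; apply: el_rel; rewrite // eq_sym.
Qed.

Lemma commgs_cong_gens x : commgs (rel I) (cong J) x -> comm_gens x.
Proof.
apply: commgs_min; first exact: comm_gens_subgroup.
exact: comm_rel_cong.
Qed.

End TwoIdeals.
End Normality.

(** * The triple commutator formula *)

Section Triple.
Variables (n : nat) (A : pzRingType).
Hypotheses (n3 : (3 <= n)%N) (hA : quasi_finite_ring A).
Implicit Types (i j l m : 'I_n) (g h : GL n A).
Notation cong I := (principal_congruence_subgroup n I).
Notation Eg := (elementary_group n A).
Notation rel I := (relative_elementary_group n I).
Local Notation yel i j a b := (comm (el i j a) (el j i b)).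
Local Open Scope group_scope.

Lemma rel_unip_pcol (I : two_sided_ideal A) (s : A) q j (v : 'I_n -> A) b :
    (forall a, s * a = a * s)%R -> q != j -> v j = s -> I b ->
  rel I (unip (pcol s q j v b * rowm j v)%R).
Proof.
move=> sC qj vj Ib; have [k /andP[kq kj]] := third_index q j n3.
have qk : q != k by rewrite eq_sym.
have jk : j != k by rewrite eq_sym.
have [I1 IM IV] := rel_subgroup n I; have nI := @rel_normal n A I.
have [E1 EM EV] := Eg_subgroup n A.
rewrite (unip_pcol sC b kq kj qj vj); apply: (IM); last first.
  apply: prod_in => [|l /andP[lj lq]]; first exact: rel_subgroup.
  apply: (IM); apply: el_rel; rewrite 1?eq_sym //.
    by apply: Defs.idealMr; apply: idealMl.
  by apply: idealN; apply: Defs.idealMr; apply: idealMl.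
have HI : rel I (el k j (b * s)%R * el k q (b * v q)%R).
  by apply: IM; apply: el_rel => //; apply: Defs.idealMr.
apply: (IM); last exact: IV.
by apply: nI => //; apply: (EM); apply: el_Eg.
Qed.

Variables I J K : two_sided_ideal A.
Let H := commgs (rel I) (rel J).
Let T := commgs H (rel K).

Lemma triple_normal : normalizes setT T.
Proof.
by apply: normalizes_commgs; [apply: sub_normal_commgs|apply: rel_normal_GL].
Qed.

Section Quotient.
Variables (D : groupType) (p : GL n A -> D).
Hypothesis pM : forall x z, p (x * z) = p x * p z.
Hypothesis pT : forall x, p x = 1 <-> T x.

Let p1 : p 1 = 1.
Proof. exact: hom_group1. Qed.
Let pV x : p x^-1 = (p x)^-1.
Proof. exact: hom_groupV. Qed.
Let pC x z : p (comm x z) = comm (p x) (p z). Proof. exact: hom_comm. Qed.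

Let Kp (x : D) := exists2 k, rel K k & x = p k.
Let Hp (x : D) := exists2 h, H h & x = p h.
Let e i j a := p (el i j a).
Let St : steinberg e. Proof. exact: steinberg_el. Qed.

Lemma H_K_commute x z : Kp x -> Hp z -> commute x z.
Proof.
move=> [k Kk ->] [u Hu ->]; apply/commute_sym/comm_eq1; rewrite -pC.
by apply/pT; apply: commgs_comm.
Qed.

Lemma triple_pairing : pairing e I J K Kp Hp.
Proof.
have [K1 KM KV] := rel_subgroup n K.
have [H1 HM HV] := commgs_subgroup (rel I) (rel J).
have el_H x i j : i != j -> sym_product I J x -> H (el i j x).
  by move=> ij Lx; apply: rel_sym_product_sub => //; apply: el_rel.
split=> [_ _ [u Ku ->] [v Kv ->]|_ [u Ku ->]|i j c _ ij [u Ku ->]||||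
  i j a b ij Ia Jb|i j a b ij Ia Jb].
- by exists (u * v); rewrite ?pM //; apply: KM.
- by exists u^-1; rewrite ?pV //; apply: KV.
- exists (el i j c * u * (el i j c)^-1); last by rewrite !pM pV.
  by apply: rel_normal => //; apply: el_Eg.
- by move=> i j k ij Kk; exists (el i j k) => //; apply: el_rel.
- exact: H_K_commute.
- move=> i j a b ij Ia Jb; exists (yel i j a b); last by rewrite pC.
  by apply: commgs_comm; apply: el_rel; rewrite // eq_sym.
- by exists (el i j (a * b)%R) => //; apply: el_H => //; apply: sym_product_l.
- by exists (el i j (b * a)%R) => //; apply: el_H => //; apply: sym_product_r.
Qed.

Let PD := triple_pairing.

(** * Commutation with a matrix whose pivot is invertible up to [s] *)

Section Pivot.
Variables (s x a b : A) (i j : 'I_n) (g : GL n A).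
Hypothesis sC : forall c, (s * c = c * s)%R.
Hypotheses (ij : i != j) (Ia : I a) (Jb : J b) (Kg : cong K g).
Let V := unit_inv g.
Let U := unit_val g.
Let yy : A := V i i.
Hypotheses (yx : (yy * x)%R = s) (xy : (x * yy)%R = s).

Let al : A := (x * a)%R.
Let W : 'M[A]_n := (E i j (al * s) - E i i (al * (V j i * x)))%R.
Let P := unip (V * W)%R.
(** Row [i] of [g * P * g^-1 - 1] is al r; the second term makes [r i] vanish. *)
Let r m : A := (s * V j m - V j i * x * V i m)%R.
Let b' : A := (s * s * b)%R.

Let ji : j != i. Proof. by rewrite eq_sym. Qed.
Let Ial : I al. Proof. exact: idealMl. Qed.
Let Jb' : J b'. Proof. exact: idealMl. Qed.
Let KU l m : l != m -> K (U l m).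
Proof. by move=> lm; have /congP/(_ l m) := Kg; rewrite (negPf lm) subr0. Qed.
Let KV l m : l != m -> K (V l m).
Proof. by move=> lm; have := congVP Kg l m; rewrite (negPf lm) subr0. Qed.
Let KU1 m : K (U m m - 1)%R.
Proof. by have /congP/(_ m m) := Kg; rewrite eqxx. Qed.
Let KV1 m : K (V m m - 1)%R.
Proof. by have := congVP Kg m m; rewrite eqxx. Qed.

Let r_i : r i = 0.
Proof. by rewrite /r -[(V j i * x * V i i)%R]mulrA xy sC subrr. Qed.

Let VU l m : (\sum_q V l q * U q m = (l == m)%:R)%R.
Proof.
have := congr1 (fun M : 'M_n => M l m) (unit_Vval g).
by rewrite !mxE.
Qed.

Let r_U : (\sum_m r m * U m j = s)%R.
Proof.
transitivity (s * (\sum_m V j m * U m j) - V j i * x * (\sum_m V i m * U m j))%R.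
  rewrite !mulr_sumr -sumrB; apply: eq_bigr => m _.
  by rewrite mulrBl !mulrA.
by rewrite !VU eqxx (negPf ij) mulr0 subr0 mulr1.
Qed.

Let Kr m : m != j -> K (r m).
Proof.
move=> mj; apply: idealB; first by apply: idealMl; apply: KV; rewrite eq_sym.
by apply: Defs.idealMr; apply: Defs.idealMr; apply: KV.
Qed.

(** By [unip_colblock], [P] is a block commutator times elementary factors. The latter commute with
    Q = e_ji(b') modulo [T], since V_li in [K] makes e_li(V_li al s b') trivial. By [ecomm_block]
    the former acts as e_ij(V_ii x a s) = e_ij(s^2 a). *)
Let commP : p (comm P (el j i b')) = p (yel i j (s * s * a)%R b').
Proof.
have [k /andP[ki kj]] := third_index i j n3.
have dc : (s * V j i = V j i * x * V i i)%R by rewrite -mulrA xy sC.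
rewrite /P (unip_colblock al ki kj ij dc) pC pM comm_mull.
set Q := p (el j i b').
have -> : comm (p (\prod_(l | (l != i) && (l != j))
    (el l j (V l i * al * s)%R * el l i (- (V l i * al * (V j i * x)))%R))) Q = 1.
  apply/comm_eq1/commute_sym.
  elim/big_rec: _ => [|l u /andP[li lj] cu]; first by rewrite p1; apply: commute1.
  rewrite pM; apply: commuteM => //; rewrite pM; apply: commuteM.
    apply/commute_sym/comm_eq1; rewrite -[p _]/(e l j _) (stS St) //.
    have -> : (V l i * al * s * b' = V l i * (al * (s * b')))%R.
      by rewrite !mulrA.
    by apply: (st_K_IJ n3 St PD) => //; [apply: KV|apply: idealMl].
  by apply/comm_eq1; rewrite -pC el_comm ?p1 // 1?eq_sym.
rewrite mulg1 mulgV mul1g !pC !pM.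
rewrite -/(e i k _) -/(e j k _) -/(e k j _) -/(e k i _) -/(e j i _).
rewrite (ecomm_block n3 St PD (V i i) s) //; last 2 first.
- exact: KV.
- by apply: Defs.idealMr; apply: KV.
have ssa : (s * a * s = s * s * a)%R by rewrite -mulrA -sC mulrA.
by rewrite /ecomm /al !mulrA yx ssa.
Qed.

Let v l : A := (x * V i l)%R.
Let bq q : A := (U q j * b * yy)%R.
Let Sq q := unip (pcol s q i v (bq q) * rowm i v)%R.
Let Rm m := el i m (al * r m)%R.
Let vi : v i = s. Proof. exact: xy. Qed.
Let Kv l : l != i -> K (v l).
Proof. by move=> li; apply: idealMl; apply: KV; rewrite eq_sym. Qed.
Let Jbq q : J (bq q).
Proof. by apply: Defs.idealMr; apply: idealMl. Qed.
Let Ialr m : I (al * r m)%R. Proof. exact: Defs.idealMr. Qed.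

(** The commutator is a product of two elementary elements whose entries are products from [J], [I]
    and [K]; the factor in [K] is U_qj if q != j, and r_m if q = j. *)
Let cross m q : m != i -> q != i -> q != m -> commute (p (Rm m)) (p (Sq q)).
Proof.
move=> mi qi qm; have im : i != m by rewrite eq_sym.
have mq : m != q by rewrite eq_sym.
have iq : i != q by rewrite eq_sym.
apply/commute_sym/comm_eq1; rewrite -pC /Sq /Rm.
rewrite comm_unip; [|exact: pcol_pcol|exact: Esq|]; last first.
  by rewrite mulrA /pcol mulrBr !EE0 // subr0 mul0r.
rewrite -mulrA rowm_E vi /pcol mulrBl !EEid -EN -unipM; first last.
- by rewrite EE0.
- by rewrite EE0 // eq_sym.
- by rewrite EE0.
- by rewrite EE0.
rewrite pM -[p _]/(e q m _) -[X in _ * X]/(e i m _).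
have [jq|jq] := eqVneq q j; last first.
  have KUq : K (U q j) by apply: KU.
  have -> : (s * bq q * (s * (al * r m)) = s * U q j * (b * (yy * s) * (al * r m)))%R.
    by rewrite /bq !mulrA.
  have -> : (- (v q * bq q * (s * (al * r m)))
            = - (v q * U q j) * (b * (yy * s) * (al * r m)))%R.
    by rewrite /bq !mulrA !mulNr.
  rewrite !(st_K_JI n3 St PD) ?mulg1 //; try exact: Defs.idealMr.
    by apply: idealN; apply: idealMl.
  exact: idealMl.
have Krm : K (r m) by apply: Kr; rewrite -jq eq_sym.
have -> : (s * bq q * (s * (al * r m)) = s * bq q * (s * al) * r m)%R.
  by rewrite !mulrA.
have -> : (- (v q * bq q * (s * (al * r m))) = - (v q * bq q) * (s * al) * r m)%R.
  by rewrite !mulNr !mulrA.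
rewrite !(st_JI_K n3 St PD) ?mulg1 //; try exact: idealMl.
by apply: idealN; apply: idealMl.
Qed.

(** The mirror image of [commP]: [ecomm_block] is used with [I] and [J] exchanged, and the corner
    entry s (U_mj b yy) s is U_mj b' yy. *)
Let main m : m != i ->
  comm (p (Rm m)) (p (Sq m)) = ecomm e i m (al * r m)%R (U m j * (b' * yy))%R.
Proof.
move=> mi; have im : i != m by rewrite eq_sym.
have [k /andP[ki km]] := third_index i m n3.
rewrite /Sq (unip_pcol sC (bq m) km ki mi vi) pM comm_mulr.
set X := p (Rm m).
have -> : comm X (p (\prod_(l | (l != i) && (l != m))
    (el m l (s * bq m * v l)%R * el i l (- (v m * bq m * v l))%R))) = 1.
  apply/comm_eq1; elim/big_rec: _ => [|l u /andP[li lm] cu].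
    by rewrite p1; apply: commute1.
  have il : i != l by rewrite eq_sym.
  have ml : m != l by rewrite eq_sym.
  rewrite pM; apply: commuteM => //; rewrite pM; apply: commuteM.
    apply/comm_eq1; rewrite /X -[p _]/(e i m _) -[X in comm _ X]/(e m l _) (stS St) //.
    have -> : (al * r m * (s * bq m * v l) = al * r m * (s * bq m) * v l)%R.
      by rewrite !mulrA.
    by apply: (st_IJ_K n3 St PD) => //; [apply: Kv|apply: idealMl].
  by apply/comm_eq1; rewrite -pC el_comm ?p1 // 1?eq_sym.
rewrite mulg1 mulgV mulg1 -comm_inv pC !pM.
have -> : (bq m * v m = - (bq m * - v m))%R by rewrite mulrN opprK.
rewrite /X -/(e m k _) -/(e i k _) -/(e k i _) -/(e k m _) -/(e i m _).
rewrite (ecomm_block n3 St (pairing_sym PD) s s) //; last 2 first.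
- by apply: idealN; apply: Kv.
- by apply: idealN; apply: Kv.
rewrite ecommV; congr (ecomm _ _ _ _ _); rewrite /bq /b' sC !mulrA.
have ssC c : (c * s * s = s * s * c)%R.
  by rewrite -[RHS]mulrA [RHS]sC [(s * c)%R]sC.
by rewrite !ssC !mulrA.
Qed.

Let RK := (\prod_(m | (m != i) && (m != j)) Rm m).
Let SK := (\prod_(q | (q != i) && (q != j)) Sq q).

Let RK_Kp : Kp (p RK).
Proof.
exists RK => //; apply: prod_in => [|m /andP[mi mj]]; first exact: rel_subgroup.
by apply: el_rel; rewrite 1?eq_sym //; apply: idealMl; apply: Kr.
Qed.

Let SK_Kp : Kp (p SK).
Proof.
exists SK => //; apply: prod_in => [|q /andP[qi qj]]; first exact: rel_subgroup.
apply: rel_unip_pcol => //; apply: Defs.idealMr; apply: Defs.idealMr.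
exact: KU.
Qed.

Let WV : (W * V = \sum_m E i m (al * r m))%R.
Proof.
rewrite /W mulrBl (E_mul_rowm i j) (E_mul_rowm i i) !E_rowm -sumrB; apply: eq_bigr => m _.
by rewrite -EB /r mulrBr !mulrA.
Qed.

Let WVW : (W * V * W = 0)%R.
Proof.
rewrite WV mulr_suml big1 // => m _; have [->|mi] := eqVneq m i.
  by rewrite r_i mulr0 E0 mul0r.
by rewrite /W mulrBr !EE0 // subr0.
Qed.

Let conjP : g * P * g^-1 = RK * Rm j.
Proof.
rewrite unip_conj; last by rewrite mulrA -(mulrA V) -(mulrA V) WVW mulr0.
rewrite -/V mulrA unit_valV mul1r WV (bigD1 i) //= r_i mulr0 E0 add0r.
rewrite unip_sum => [|m m' mi _]; last by rewrite EE0.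
have [m m' mi _|_ eqR] := @prod_unipD1 _ _ (fun m => m != i)
  (fun m => E i m (al * r m)%R) j ji; [by rewrite EE0|exact: eqR].
Qed.

Let conjQ : g * el j i b' * g^-1 = SK * Sq j.
Proof.
rewrite unip_conj ?Esq // (conj_E_decomposition sC b ji yx xy) -/V -/U.
rewrite unip_sum => [|q q' _ _]; last exact: pcol_pcol.
have [q q' _ _|_ eqS] := @prod_unipD1 _ _ (fun q => q != i)
  (fun q => pcol s q i v (bq q) * rowm i v)%R j ji; [exact: pcol_pcol|exact: eqS].
Qed.

(** By [cross] only the factor at [m] counts; [ecomm_shift] then brings U_mj, which lies in [K], to
    the first argument and replaces [m] by [j]. *)
Let comm_SK m : m != i -> m != j ->
  comm (p (Rm m)) (p SK) = ecomm e i j (al * r m * U m j)%R (b' * yy)%R.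
Proof.
move=> mi mj.
have -> : SK = Sq m * \prod_(q | (q != i) && (q != j) && (q != m)) Sq q.
  have mij : (m != i) && (m != j) by rewrite mi mj.
  have [q q' _ _|eqS _] := @prod_unipD1 _ _ (fun q => (q != i) && (q != j))
    (fun q => pcol s q i v (bq q) * rowm i v)%R m mij; [exact: pcol_pcol|exact: eqS].
rewrite pM comm_mulr.
have -> : comm (p (Rm m)) (p (\prod_(q | (q != i) && (q != j) && (q != m)) Sq q)) = 1.
  apply/comm_eq1; elim/big_rec: _ => [|q u /andP[/andP[qi qj] qm] cu].
    by rewrite p1; apply: commute1.
  by rewrite pM; apply: commuteM => //; apply: cross.
rewrite mulg1 mulgV mulg1 main //; symmetry.
apply: (ecomm_shift St PD) => //; last exact: KU.
exact: Defs.idealMr.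
Qed.

Let sum_rU : (\sum_(m | (m != i) && (m != j)) al * r m * U m j
              + al * r j * U j j = al * s)%R.
Proof.
rewrite -r_U mulr_sumr [RHS](bigD1 i) //= r_i mul0r mulr0 add0r.
rewrite [RHS](bigD1 j) //= addrC mulrA; congr (_ + _)%R.
by apply: eq_bigr => m _; rewrite mulrA.
Qed.

(** The mixed commutators of [Rm j] with [SK] and of [RK] with [Sq j] vanish by [cross]. What
    remains are the y_ij(al r_m U_mj, b' yy) for all m != i, and by additivity and [sum_rU] their
    first arguments sum to [al * s]. *)
Let comm_RS : comm (p (RK * Rm j)) (p (SK * Sq j)) = ecomm e i j (al * s)%R (b' * yy)%R.
Proof.
have Jb'y : J (b' * yy)%R by apply: Defs.idealMr.
have Hy' a' : I a' -> Hp (ecomm e i j a' (b' * yy)%R).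
  by move=> Ia'; apply: (pairing_Hy PD).
have KH' z t : Kp z -> Hp t -> z * t * z^-1 = t.
  by move=> Kz Hh; apply/conj_fix/(pairing_KH PD).
have Rj : comm (p (Rm j)) (p SK) = 1.
  apply/comm_eq1; rewrite /SK; elim/big_rec: _ => [|q u /andP[qi qj] cu].
    by rewrite p1; apply: commute1.
  by rewrite pM; apply: commuteM => //; apply: cross.
have Sj : comm (p RK) (p (Sq j)) = 1.
  apply/comm_eq1/commute_sym; rewrite /RK; elim/big_rec: _ => [|m u /andP[mi mj] cu].
    by rewrite p1; apply: commute1.
  by rewrite pM; apply: commuteM => //; apply/commute_sym/cross; rewrite // eq_sym.
have Yj : comm (p (Rm j)) (p (Sq j)) = ecomm e i j (al * r j * U j j)%R (b' * yy)%R.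
  by rewrite main // (ecomm_unit n3 St PD ij (Ialr j) Jb'y (KU1 j)).
have [Isum YK] : I (\sum_(m | (m != i) && (m != j)) al * r m * U m j)%R /\
    comm (p RK) (p SK) = ecomm e i j (\sum_(m | (m != i) && (m != j)) al * r m * U m j)%R
                                 (b' * yy)%R.
  rewrite /RK; elim/big_rec2: _ => [|m t u /andP[mi mj] [It cu]].
    by split; [apply: ideal0|rewrite p1 comm_1l /ecomm (st0 St) // comm_1l].
  have Im : I (al * r m * U m j)%R by apply: Defs.idealMr.
  split; first exact: idealD.
  rewrite (ecomm_addl St PD ij It Im Jb'y); last by apply: idealMl; apply: KU.
  rewrite pM comm_mull cu comm_SK // KH' //; last exact: Hy'.
  exists (Rm m) => //; apply: el_rel; rewrite 1?eq_sym //.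
  by apply: idealMl; apply: Kr.
rewrite !pM comm_mull !comm_mulr Rj Sj mul1g mulg1 mulgV mulg1 Yj YK.
rewrite (KH' (p SK)) //; last by apply: Hy'; apply: Defs.idealMr.
rewrite (KH' (p RK)) //; last by apply: Hy'; apply: Defs.idealMr.
rewrite -(ecomm_addl St PD ij) ?sum_rU //; first exact: Defs.idealMr.
apply: big_ind => [|u t Ku Kt|m /andP[mi mj]]; [exact: ideal0|exact: idealD|].
by apply: idealMl; apply: KU.
Qed.

(** Conjugation by [g] turns [P, Q] into [comm_RS]; moving yy = V_ii, an element of 1 + K, to the
    first argument gives back y_ij(s^2 a, b'). *)
Lemma yel_commute_pivot : commute (p g) (p (yel i j (s * s * a)%R (s * s * b)%R)).
Proof.
have Ia' : I (al * s)%R by apply: Defs.idealMr.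
have S4 : ecomm e i j (al * s)%R (b' * yy)%R = ecomm e i j (s * s * a)%R b'.
  rewrite -[LHS]ecommV (ecomm_unit n3 St (pairing_sym PD) ji Jb' Ia' (KV1 i)) ecommV.
  by congr (ecomm _ _ _ _ _); rewrite /al !mulrA yx -mulrA -sC mulrA.
have conj_g : p (g * comm P (el j i b') * g^-1) = p (comm P (el j i b')).
  rewrite comm_conj conjP conjQ pC comm_RS S4 commP pC.
  by [].
have pY := commP; rewrite -/b' -pY.
rewrite /commute -[in RHS]conj_g -pM -pM; congr p.
by rewrite mulgVK.
Qed.

End Pivot.
(** The double commutator formula for IJ + JI and [K]: the commutator lies in
    [E(n, A, IJ + JI), E(n, A, K)], which [rel_sym_product_sub] places in [T]. *)
Lemma rel_sym_product_commute x g :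
  rel (sym_product I J) x -> cong K g -> commute (p g) (p x).
Proof.
move=> Nx Kg; apply/commute_sym/comm_eq1; rewrite -pC; apply/pT.
have := comm_gens_sub n3 hA (comm_rel_cong n3 hA Nx Kg).
apply: commgs_min; first exact: commgs_subgroup.
move=> u w Nu Kw; apply: commgs_comm => //; exact: rel_sym_product_sub.
Qed.

Lemma yel_commute i j a b g : i != j -> I a -> J b -> cong K g ->
  commute (p g) (p (yel i j a b)).
Proof.
move=> ij Ia Jb Kg; have [R [phi [phiC qfA]]] := hA.
have ji : j != i by rewrite eq_sym.
pose Q r := forall a b, I a -> J b -> commute (p g) (p (yel i j (phi r * a)%R b)).
suff: Q 1%R by move=> /(_ a b Ia Jb); rewrite rmorph1 mul1r.
apply: (local_global phiC qfA (a := unit_inv g i i) (w := unit_val g i i)).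
- move=> a1 b1 Ia1 Jb1; rewrite rmorph0 mul0r el0 comm_1l p1.
  exact: commute1.
- move=> r r' Qr Qr' a1 b1 Ia1 Jb1; rewrite rmorphD mulrDl elD // comm_mull pM.
  apply: commuteM (Qr _ _ Ia1 Jb1).
  (* Conjugating [Y] by [z] changes it by an element of E(n, A, IJ + JI), which commutes with [g]
     modulo [T]. *)
  set Y := comm (el i j (phi r' * a1)%R) _; set z := el i j _.
  rewrite -[z * Y * _](mulgVK Y) pM; apply: commuteM; last exact: Qr'.
  apply: rel_sym_product_commute => //; apply: yel_central => //.
    exact: idealMl.
  exact: el_Eg.
- move=> r r' Qr' a1 b1 Ia1 Jb1; rewrite mulrC rmorphM -mulrA.
  by apply: Qr' => //; apply: idealMl.
(* [yel_commute_pivot] needs s^2 in both arguments; [yel_shift] distributes the fourth power. *)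
move=> c r x t yx xy; exists 4%N => a1 b1 Ia1 Jb1.
pose s := phi r; pose eps := \prod_(q | q != i) el q i (unit_val g q i * c)%R.
have Keps : rel K eps.
  apply: prod_in => [|q qi]; first exact: rel_subgroup.
  apply: el_rel => //; apply: Defs.idealMr; have /congP/(_ q i) := Kg.
  by rewrite (negPf qi) subr0.
have Kg' : cong K (eps^-1 * g).
  have [_ KM KV] := cong_subgroup n K.
  by apply: (KM) => //; apply: KV; apply: rel_cong.
have Issa : I (s * s * a1)%R by apply: idealMl.
have Jssb : J (s * s * b1)%R by apply: idealMl.
have ss : (s * s = phi (r ^+ 2))%R by rewrite expr2 rmorphM.
have -> : (phi (r ^+ 4) * a1 = s * s * a1 * (s * s))%R.
  by rewrite ss -phiC mulrA -rmorphM -exprD.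
set Y1 := comm _ _; pose Y2 := yel i j (s * s * a1)%R (s * s * b1)%R.
rewrite -[Y1](mulgVK Y2) pM; apply: commuteM.
  by apply: rel_sym_product_commute => //; apply: yel_shift.
(* [eps] is in E(n, A, K) and [Y2] in [E(n, A, I), E(n, A, J)], so they commute modulo [T]; this
   leaves [eps^-1 * g], whose pivot is invertible up to [s]. *)
rewrite -[g](mulVKg eps) pM; apply/commute_sym/commuteM.
  apply/commute_sym/H_K_commute; first by exists eps.
  by exists Y2 => //; apply: commgs_comm; apply: el_rel.
apply: commute_sym; apply: (yel_commute_pivot (x := x)) => //.
- by move=> d; apply: phiC.
- by rewrite pivot_factor.
- by rewrite pivot_factor.
Qed.

Lemma comm_gens_commute x g : comm_gens I J x -> cong K g -> commute (p g) (p x).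
Proof.
move=> + Kg; move: x; apply: gen_min.
  split=> [|u w cu cw|u cu].
  - by rewrite p1; apply: commute1.
  - by rewrite pM; apply: commuteM.
  - by rewrite pV; apply: commuteV.
move=> u [Nu|[i [j [a [b [ij Ia Jb ->]]]]]]; first exact: rel_sym_product_commute.
exact: yel_commute.
Qed.

End Quotient.
End Triple.

Theorem mainTheorem2 (n : nat) (hn : (3 <= n)%N) (A : pzRingType)
    (hA : quasi_finite_ring A) (I J K : two_sided_ideal A) :
  commgs
    (commgs (relative_elementary_group n I) (principal_congruence_subgroup n J))
    (principal_congruence_subgroup n K)
  = commgs
    (commgs (relative_elementary_group n I) (relative_elementary_group n J))
    (relative_elementary_group n K).
Proof.
set T := RHS; rewrite eqEsubset; split.
  apply: commgs_min => [|h g Hh Kg]; first exact: commgs_subgroup.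
  have [D [p [pM pT]]] := quotient_group_exists (commgs_subgroup _ _)
    (triple_normal hn hA (I := I) (J := J) (K := K)).
  apply/pT; rewrite hom_comm //; apply/comm_eq1/commute_sym.
  by apply: (comm_gens_commute hn hA pM pT) => //; apply: commgs_cong_gens.
apply: commgs_min => [|h g Hh Kg]; first exact: commgs_subgroup.
apply: commgs_comm; last exact: rel_cong.
move: Hh; apply: commgs_min => [|x z Ix Jz]; first exact: commgs_subgroup.
by apply: commgs_comm => //; apply: rel_cong.
Qed.
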